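(* Let $p>1$ and $K>0$ be constants, and let $h\ge 0$ satisfy $$\operatorname{div}\left(|Dh|^{p-2}Dh\right)=K\,x_ih_i\,|Dh|^{p-2}\qquad\text{on }\mathbb{R}^n.$$ Then $h$ must be constant.
   Context: Here $h$ is a real-valued function on $\mathbb{R}^n$, $x=(x_1,\dots,x_n)$ are the coordinates on $\mathbb{R}^n$, $h_i=\partial h/\partial x_i$, $Dh=(h_1,\dots,h_n)$ is the gradient of $h$, $|\cdot|$ is the Euclidean norm, $\operatorname{div}$ is the divergence on $\mathbb{R}^n$, and repeated indices are summed, so $x_ih_i=\sum_{i=1}^n x_i\,\partial h/\partial x_i$. *)

(* Defs.v *)
From HB Require Import structures.
From mathcomp Require Import all_boot all_order all_algebra.
From mathcomp Require Import all_classical all_reals all_analysis.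
Set Implicit Arguments.
Unset Strict Implicit.
Unset Printing Implicit Defensive.
Import Order.TTheory GRing.Theory Num.Theory.
Import numFieldNormedType.Exports.
Local Open Scope classical_set_scope.
Local Open Scope ring_scope.

Section Calculus.
Context {R : realType} {n : nat}.
Implicit Types (f : 'rV[R]_n -> R) (V : 'rV[R]_n -> 'rV[R]_n).

Definition partial (i : 'I_n) f (x : 'rV[R]_n) : R := 'D_(delta_mx 0 i) f x.

Definition grad f (x : 'rV[R]_n) : 'rV[R]_n := \row_i partial i f x.

Definition divergence V (x : 'rV[R]_n) : R :=
  \sum_i partial i (fun y => V y 0 i) x.

(* The library norm `|v| on 'rV[R]_n is the sup norm, hence this definition. *)
Definition enorm (v : 'rV[R]_n) : R := Num.sqrt (\sum_i v 0 i ^+ 2).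

(* C^oo: every iterated partial derivative is differentiable everywhere
   (hence every iterated partial derivative is also continuous). *)
Definition smooth f : Prop :=
  forall (s : seq 'I_n) (x : 'rV[R]_n), differentiable (foldr partial f s) x.

Definition test_function f : Prop :=
  smooth f /\ compact (closure [set x | f x != 0]).

Definition continuously_differentiable f : Prop :=
  (forall x, differentiable f x) /\ continuous (grad f).

End Calculus.

(* Integral over R^n as an iterated one-dimensional Lebesgue integral. It is
   only applied to continuous functions with compact support, for which it is
   the n-dimensional Lebesgue integral by Fubini's theorem. *)
Fixpoint integral_Rn {R : realType} (n : nat) : ('rV[R]_n -> R) -> R :=
  match n with
  | 0 => fun f => f 0
  | m.+1 => fun f : 'rV[R]_(1 + m) -> R =>
      Rintegral (@lebesgue_measure R) setT
        (fun t : R => integral_Rn (fun y : 'rV[R]_m => f (row_mx t%:M y)))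
  end.

Section Equation.
Context {R : realType} {n : nat}.
Variables (p K : R) (h : 'rV[R]_n -> R).

(* |Dh|^{p-2} Dh. Where Dh = 0 this is 0 for every p, which is its continuous
   extension when 1 < p. *)
Definition pflux (x : 'rV[R]_n) : 'rV[R]_n :=
  (enorm (grad h x) `^ (p - 2)) *: grad h x.

(* K x_i h_i |Dh|^{p-2}, likewise 0 where Dh = 0. *)
Definition drift (x : 'rV[R]_n) : R :=
  K * (\sum_i x 0 i * partial i h x) * enorm (grad h x) `^ (p - 2).

Definition classical_solution : Prop :=
  [/\ forall x, differentiable h x,
      forall x, differentiable pflux x
    & forall x, divergence pflux x = drift x].

(* The divergence is taken in the sense of distributions, as is usual for
   equations of p-Laplace type, where pflux need not be differentiable. *)
Definition weak_solution : Prop :=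
  continuously_differentiable h /\
  forall phi : 'rV[R]_n -> R, test_function phi ->
    - integral_Rn (fun x => \sum_i pflux x 0 i * partial i phi x)
    = integral_Rn (fun x => drift x * phi x).

End Equation.

(* Main.v *)
(* Both kinds of solution satisfy a comparison principle against the functions
   v(x) = c exp(-alpha |x-y|^2) + k with alpha c > 0, wherever v is a strict
   subsolution, that is, n + p - 2 < K x.(x-y) + 2 alpha (p-1) |x-y|^2 and x <> y.
   For a weak solution one tests with exp(-K|x|^2/2) max(v-h,0)^2 (after extending
   the weak formulation to C^1 test functions by mollification) and uses the
   monotonicity of q |-> |q|^(p-2) q; for a classical one, the second derivative
   test at an interior maximum of v-h. With y = 0 and alpha, c < 0 the barriers tend
   to -oo, so comparison on R^n and h >= 0 force h to attain its minimum. With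
   alpha large, Hopf's boundary point argument then makes h constant. *)
Require Import Defs.
From mathcomp Require Import all_boot all_order all_algebra.
From mathcomp Require Import all_classical all_reals all_analysis.
From mathcomp Require Import ring lra.
Import Order.TTheory GRing.Theory Num.Theory.
Import numFieldNormedType.Exports.
Local Open Scope classical_set_scope.
Local Open Scope ring_scope.

Set Implicit Arguments.
Unset Strict Implicit.
Unset Printing Implicit Defensive.

(** * Continuous functions with compact support and their integral *)

(** Write F for the flux |Dh|^(p-2) Dh; the equation reads div F = K x.F. The flux of a Gaussian
    barrier is radial, -w(s)(x-y) with s = |x-y|^2 and w > 0, so its divergence and its drift are
    explicit multiples of w; comparing them gives the inequality of the overview. Since the gradient
    of exp(-K|x|^2/2) is -K x times itself, this weight turns the equation into div(exp(-K|x|^2/2)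
    F) = 0, and only the monotone principal part remains to be estimated.

    The equation degenerates where Dh = 0, so barriers are compared with h only away from their
    centre y, where their gradient is nonzero. All the analysis is condensed into
    [comparison_property], stated with a compact contact set inside an open set instead of boundary
    values; it thus serves both on the whole space and on a small ball.

    For the iterated integral, everything comes from linearity, positivity, translation invariance
    and a bound by supremum times volume, all for continuous functions with support in a fixed
    cube. *)

Lemma continuousP_eps (R : realType) (V : normedModType R) (f : V -> R) x :
  {for x, continuous f} <->
  forall e, 0 < e -> exists2 d, 0 < d & forall y, `|x - y| < d -> `|f x - f y| < e.
Proof.
split=> [cf e e0|H].
  have /cvgrPdist_lt /(_ e e0) := cf.
  by move=> /nbhs_normP[d d0 H]; exists d => // y xy; apply: H.
apply/cvgrPdist_lt => e e0; have [d d0 H'] := H e e0.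
by apply/nbhs_normP; exists d => // y /=; apply: H'.
Qed.

Section ContinuityRules.
Context {R : realType} {T : topologicalType}.
Implicit Types (f g : T -> R) (x : T).

Lemma continuous_at_mul f g x : continuous_at x f -> continuous_at x g ->
  continuous_at x (fun y => f y * g y).
Proof. by move=> cf cg; apply: (@cvgM R). Qed.

Lemma continuous_at_add f g x : continuous_at x f -> continuous_at x g ->
  continuous_at x (fun y => f y + g y).
Proof. by move=> cf cg; apply: (@cvgD _ R^o). Qed.

Lemma continuous_at_sub f g x : continuous_at x f -> continuous_at x g ->
  continuous_at x (fun y => f y - g y).
Proof. by move=> cf cg; apply: (@cvgB _ R^o). Qed.

Lemma continuous_at_cst (c : R) x : continuous_at x (fun _ : T => c).
Proof. exact: cst_continuous. Qed.

Lemma continuous_at_comp (phi : R -> R) f x :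
  continuous_at x f -> continuous_at (f x) phi ->
  continuous_at x (fun y => phi (f y)).
Proof. by move=> cf cphi; apply: (@continuous_comp _ _ _ f phi). Qed.

Lemma is_derive_continuous (phi : R -> R) (t a : R) :
  is_derive t 1 phi a -> continuous_at t phi.
Proof. by case=> d _; apply: differentiable_continuous; apply/derivable1_diffP. Qed.

End ContinuityRules.

(** Only [x] is confined to [A], while [y] ranges over the whole space. The near-covering form of
    compactness turns the local choices of [d] into a single one; halving it leaves room for moving
    the base point. *)
Lemma compact_unif_continuous (R : realType) (V : normedModType R)
    (f : V -> R) (A : set V) : compact A -> continuous f ->
  forall e, 0 < e -> exists2 d, 0 < d &
    forall x y, A x -> `|x - y| < d -> `|f x - f y| < e.
Proof.
move=> cA cf e e0.
have [d /= d0 H] : \forall d \near 0^'+,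
    A `<=` (fun x => forall y, `|x - y| < d -> `|f x - f y| < e).
  apply: ((compact_near_coveringP A).1 cA R (0^'+)
    (fun d x => forall y, `|x - y| < d -> `|f x - f y| < e)).
  move=> x Ax; have e2 : 0 < e / 2 by rewrite divr_gt0.
  have [d d0 H] := (continuousP_eps f x).1 (cf x) _ e2.
  exists (ball x (d / 2), [set t | t < d / 2]) => /=.
    split; first by apply: nbhsx_ballx; rewrite divr_gt0.
    by apply: nbhs_right_lt; rewrite divr_gt0.
  move=> [x' t] /= [+ td y x'y]; rewrite -ball_normE /= => xx'.
  have xd : `|x - x'| < d by rewrite (lt_trans xx')// ltr_pdivrMr// ltr_pMr// ltr1n.
  have yd : `|x - y| < d.
    rewrite (_ : x - y = (x - x') + (x' - y)); last by rewrite addrA subrK.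
    rewrite (le_lt_trans (ler_normD _ _))// [d]splitr ltrD//.
    exact: lt_trans x'y td.
  have := H _ xd; have := H _ yd => h1 h2.
  rewrite (_ : f x' - f y = (f x - f y) - (f x - f x')); last by ring.
  rewrite (le_lt_trans (ler_normB _ _))//; lra.
exists (d / 2); first by rewrite divr_gt0.
move=> x y Ax; apply: (H (d / 2)) => //=; last by rewrite divr_gt0.
rewrite sub0r normrN ger0_norm; last by rewrite divr_ge0// ltW.
by rewrite ltr_pdivrMr// ltr_pMr// ltr1n.
Qed.

Lemma rV_compact_ball (R : realType) n (M : R) :
  compact [set x : 'rV[R]_n | `|x| <= M].
Proof.
apply: bounded_closed_compact.
  exists M; split; first by rewrite num_real.
  by move=> N MN x /= xM; rewrite (le_trans xM)// ltW.
have -> : [set x : 'rV[R]_n | `|x| <= M] = (fun x => `|x|) @^-1` [set r | r <= M] by [].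
apply: closed_comp; last exact: closed_le.
by move=> x _; exact: norm_continuous.
Qed.

(** The radius [M] is explicit because the bound on the iterated integral depends on it. The norm of
    a row is the sup norm, so the ball is a cube and slices keep the same [M]. *)
Definition Cc (R : realType) (V : normedModType R) (M : R) (f : V -> R) : Prop :=
  continuous f /\ forall x, M < `|x| -> f x = 0.

Lemma Cc_unif_continuous (R : realType) (V : normedModType R) (M : R) (f : V -> R) :
  (forall r : R, compact [set x : V | `|x| <= r]) -> Cc M f ->
  forall e, 0 < e -> exists2 d, 0 < d &
    forall x y, `|x - y| < d -> `|f x - f y| < e.
Proof.
move=> cV [cf f0] e e0.
have [d d0 H] := compact_unif_continuous (cV (M + 1)) cf e0.
(* Compactness handles [x] within radius [M + 1]; farther out, a step below 1 keeps both points
   outside the support. *)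
exists (Num.min d 1); first by rewrite lt_min d0 ltr01.
move=> x y; rewrite lt_min => /andP[xyd xy1].
have [xM|Mx] := leP `|x| (M + 1); first exact: H.
rewrite (f0 x) ?(f0 y) ?subrr ?normr0 //; last by lra.
have : `|x| <= `|x - y| + `|y| by rewrite -{1}(subrK y x) ler_normD.
lra.
Qed.

Lemma Cc_bounded (R : realType) (V : normedModType R) (M : R) (f : V -> R) :
  (forall r : R, compact [set x : V | `|x| <= r]) -> Cc M f ->
  exists2 B, 0 < B & forall x, `|f x| <= B.
Proof.
move=> cV [cf f0].
have : compact (f @` [set x : V | `|x| <= M]).
  by apply: continuous_compact => //; apply: continuous_subspaceT.
move=> /compact_bounded[B [_ HB]].
exists (Num.max (B + 1) 1); first by rewrite lt_max ltr01 orbT.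
move=> x; have [xM|/f0->] := leP `|x| M; last by rewrite normr0 le_max ler01 orbT.
rewrite le_max; apply/orP; left.
by apply: (HB (B + 1)); [rewrite ltrDl|exists x].
Qed.

(** * Integrals over the line *)

Section OneDim.
Context {R : realType}.
Implicit Types (f g : R -> R) (M e a : R).
Local Notation mu := (@lebesgue_measure R).
Local Notation J f := (Rintegral mu setT f).

Lemma integrable_patch (D : set (measurableTypeR R)) f : measurable D ->
  mu.-integrable D (EFin \o f) -> mu.-integrable setT (EFin \o (f \_ D)).
Proof.
move=> mD fi; have := (integrable_mkcond _ mD).1 fi.
congr (is_true (integrable _ _ _)).
by apply/funext => x; rewrite /= !patchE; case: ifPn.
Qed.

Lemma Cc_integrable M f : Cc M f -> mu.-integrable setT (EFin \o f).
Proof.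
move=> [cf f0].
have fE : f = f \_ `[- M, M]%classic.
  apply/funext => x; rewrite patchE; case: ifPn => //.
  rewrite notin_setE /= in_itv /= -ler_norml => /negP.
  by rewrite -ltNge => /f0.
have h : mu.-integrable `[- M, M]%classic (EFin \o f).
  apply: continuous_compact_integrable; first exact: segment_compact.
  exact: continuous_subspaceT.
by rewrite fE; apply: integrable_patch.
Qed.

Lemma Cc_Rintegral_itv M f : Cc M f ->
  forall a b, a <= - M -> M <= b -> J f = Rintegral mu `[a, b]%classic f.
Proof.
move=> [cf f0] a b aM Mb; rewrite [RHS]Rintegral_mkcond.
apply: eq_Rintegral => x _; rewrite patchE; case: ifPn => //.
rewrite notin_setE /= in_itv /= => /negP ab; apply: f0.
rewrite ltNge ler_norml; apply: contra ab => /andP[h1 h2].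
by rewrite (le_trans aM)// (le_trans h2).
Qed.

Lemma Cc_Rintegral_le M f e : 0 <= M -> Cc M f -> (forall x, `|f x| <= e) ->
  `|J f| <= e * (2 * M).
Proof.
move=> M0 cf fe; rewrite (Cc_Rintegral_itv cf (lexx _) (lexx _)).
have fi : mu.-integrable `[- M, M]%classic (EFin \o f).
  apply: continuous_compact_integrable; first exact: segment_compact.
  by apply: continuous_subspaceT; case: cf.
rewrite (le_trans (le_normr_Rintegral _ fi))//.
apply: (le_trans (le_Rintegral (f2 := cst e) _ _ _ _)) => //.
- apply: continuous_compact_integrable; first exact: segment_compact.
  apply: continuous_subspaceT => x; apply: continuous_comp; last exact: norm_continuous.
  exact: cf.1.
- by apply: continuous_compact_integrable; [exact: segment_compact|exact: cst_continuous].
rewrite Rintegral_cst//= lebesgue_measure_itv /= lte_fin.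
have e0 : 0 <= e by exact: le_trans (fe 0).
case: ifP => _ /=; first by rewrite opprK mulr_natl mulr2n.
by rewrite mulr0 !mulr_ge0.
Qed.

Lemma Cc_Rintegral_shift M f a : Cc M f -> J (fun t => f (t + a)) = J f.
Proof.
(* So large that [[-B, B]] contains the support of the shifted function and [[-B + a, B + a]] that
   of [f]; substitution on a segment then applies. *)
move=> cf; pose B := `|M| + `|a| + 1.
have MB : M <= B by rewrite /B; have := ler_norm M; have := normr_ge0 a; lra.
have B0 : - B < B by rewrite /B; have := normr_ge0 M; have := normr_ge0 a; lra.
have [aB aB'] : - B <= - M + a /\ M + a <= B.
  rewrite /B; have := ler_norm M; have := ler_norm a.
  by have := ler_norm (- a); rewrite normrN; lra.
have cfa : Cc (`|M| + `|a|) (fun t => f (t + a)).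
  case: cf => cf f0; split.
    move=> x; apply: (continuous_comp (f := fun t => t + a)) => //; last exact: cf.
    by apply: cvgD; [exact: cvg_id|exact: cvg_cst].
  move=> x h; apply: f0; have := ler_norm M; have : `|x| <= `|x + a| + `|a|.
    by rewrite -{1}(addrK a x) ler_normB.
  lra.
have BB : `|M| + `|a| <= B by rewrite /B; lra.
rewrite (@Cc_Rintegral_itv _ _ cfa (- B) B) ?lerN2//.
have h1 : - B + a <= - M by rewrite /B; have := ler_norm M; have := ler_norm a; lra.
have h2 : M <= B + a by rewrite /B; have := ler_norm M; have := ler_norm (- a); rewrite normrN; lra.
rewrite (Cc_Rintegral_itv cf h1 h2) /Rintegral; congr fine.
have D1 : derive1 (fun t : R => t + a) = cst 1.
  by apply/funext => t; rewrite derive1E; exact: (congr1 (@^~ t) (derive_shift 1 a)).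
rewrite (@integration_by_substitution_increasing _ (fun t => t + a) f (- B) B) ?ltW//.
- by apply: eq_integral => t _; rewrite /= D1 /= mulr1.
- by move=> x y _ _ xy; rewrite ltrD2r.
- by rewrite D1 => x _; exact: cst_continuous.
- by rewrite D1; exact: is_cvg_cst.
- by rewrite D1; exact: is_cvg_cst.
- split => //.
  + by apply: cvgD; [apply: cvg_at_right_filter; exact: cvg_id|exact: cvg_cst].
  + by apply: cvgD; [apply: cvg_at_left_filter; exact: cvg_id|exact: cvg_cst].
- by apply: continuous_subspaceT; case: cf.
Qed.

Lemma Cc_Rintegral_gt0 M f x0 : Cc M f -> (forall x, 0 <= f x) -> 0 < f x0 ->
  0 < J f.
Proof.
move=> cf f0 fx0; have [cf' _] := cf.
have e0 : 0 < f x0 / 2 by rewrite divr_gt0.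
have [d d0 H] := (continuousP_eps f x0).1 (cf' x0) _ e0.
have d2 : x0 - d / 2 < x0 + d / 2 by lra.
pose D : set (measurableTypeR R) := `[x0 - d / 2, x0 + d / 2]%classic.
have mD : measurable D by exact: measurable_itv.
have fi : mu.-integrable D (EFin \o f).
  by apply: continuous_compact_integrable; [exact: segment_compact|exact: continuous_subspaceT].
apply: (@lt_le_trans _ _ (Rintegral mu D f)).
  apply: (@lt_le_trans _ _ (Rintegral mu D (cst (f x0 / 2)))).
    rewrite Rintegral_cst// /D /= lebesgue_measure_itv /= lte_fin d2 /=.
    by rewrite mulr_gt0//; lra.
  apply: le_Rintegral => //.
    by apply: continuous_compact_integrable; [exact: segment_compact|exact: cst_continuous].
  move=> x; rewrite /D /= in_itv /= => xD.
  have : `|x0 - x| < d.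
    by rewrite ltr_norml; move: xD => /andP[]; lra.
  by move=> /H /ltr_normlW; lra.
rewrite Rintegral_mkcond; apply: le_Rintegral => //.
- by apply: integrable_patch.
- exact: Cc_integrable cf.
by move=> x _; rewrite patchE; case: ifP.
Qed.

End OneDim.

Section RowNorm.
Context {R : realType}.

Lemma rV_coord_le n (x : 'rV[R]_n) i : `|x 0 i| <= `|x|.
Proof.
rewrite /Num.norm /= mx_normrE.
exact: (le_bigmax _ (fun ij : 'I_1 * 'I_n => `|x ij.1 ij.2|) (0, i)).
Qed.

Lemma rV_norm_le n (x : 'rV[R]_n) (c : R) : 0 <= c ->
  (forall i, `|x 0 i| <= c) -> `|x| <= c.
Proof.
move=> c0 H; rewrite /Num.norm /= mx_normrE; apply: bigmax_le => // -[i j] _ /=.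
by rewrite ord1.
Qed.

Lemma row_cons_l n (t : R) (y : 'rV[R]_n) :
  (row_mx t%:M y : 'rV[R]_(1 + n)) 0 (lshift n 0) = t.
Proof. by rewrite row_mxEl mxE eqxx mulr1n. Qed.

Lemma norm_row_cons_l n (t : R) (y : 'rV[R]_n) : `|t| <= `|row_mx t%:M y|.
Proof. by rewrite -{1}(row_cons_l t y) rV_coord_le. Qed.

Lemma norm_row_cons_r n (t : R) (y : 'rV[R]_n) : `|y| <= `|row_mx t%:M y|.
Proof.
by apply: rV_norm_le => // i; rewrite -(row_mxEr t%:M) rV_coord_le.
Qed.

Lemma norm_row_cons_le n (t : R) (y : 'rV[R]_n) : `|row_mx t%:M y| <= `|t| + `|y|.
Proof.
apply: rV_norm_le => [|i]; first by rewrite addr_ge0.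
case: (split_ordP i) => j ->.
  by rewrite ord1 row_cons_l lerDl.
by rewrite row_mxEr ler_wpDl// rV_coord_le.
Qed.

Lemma row_consB n (t s : R) (y z : 'rV[R]_n) :
  row_mx t%:M y - row_mx s%:M z = row_mx (t - s)%:M (y - z).
Proof. by rewrite opp_row_mx add_row_mx raddfB. Qed.

Lemma row_consD n (t s : R) (y z : 'rV[R]_n) :
  row_mx t%:M y + row_mx s%:M z = row_mx (t + s)%:M (y + z).
Proof. by rewrite add_row_mx raddfD. Qed.

Lemma row_cons_ex n (x : 'rV[R]_(1 + n)) : exists t y, x = row_mx t%:M y.
Proof.
exists (lsubmx x 0 0), (rsubmx x); rewrite -[LHS]hsubmxK; congr row_mx.
exact: mx11_scalar.
Qed.

End RowNorm.

(** * The iterated integral *)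

Section IntegralRn.
Context {R : realType}.

Lemma Cc_slice n (M : R) (f : 'rV[R]_(1 + n) -> R) t : Cc M f ->
  Cc M (fun y : 'rV[R]_n => f (row_mx t%:M y)).
Proof.
move=> [cf f0]; split.
  move=> y; apply/continuousP_eps => e e0.
  have [d d0 H] := (continuousP_eps f _).1 (cf (row_mx t%:M y)) _ e0.
  exists d => // z yz; apply: H; rewrite row_consB subrr.
  by rewrite (le_lt_trans (norm_row_cons_le _ _))// normr0 add0r.
by move=> y My; apply: f0; rewrite (lt_le_trans My)// norm_row_cons_r.
Qed.

Lemma CcZD (V : normedModType R) (M a : R) (f g : V -> R) : Cc M f -> Cc M g ->
  Cc M (fun x => a * f x + g x).
Proof.
move=> [cf f0] [cg g0]; split.
  move=> x; apply: (@cvgD _ R^o); last exact: cg.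
  by apply: (@cvgM R); [exact: cvg_cst|exact: cf].
by move=> x Mx; rewrite f0// g0// mulr0 addr0.
Qed.

Definition integral_bounded n := forall (M e : R) (f : 'rV[R]_n -> R), 0 <= M ->
  Cc M f -> (forall x, `|f x| <= e) -> `|integral_Rn f| <= e * (2 * M) ^+ n.

Definition integral_linear n := forall (M a : R) (f g : 'rV[R]_n -> R), 0 <= M ->
  Cc M f -> Cc M g ->
  integral_Rn (fun x => a * f x + g x) = a * integral_Rn f + integral_Rn g.

(** Linearity makes the difference of two slice integrals the integral of a difference, which
    uniform continuity and the bound make small. Continuity of the inner integral thus uses both
    properties in dimension [n], and this is why the induction carries them together. *)
Lemma Cc_slice_integral n : integral_bounded n -> integral_linear n ->
  forall (M : R) (f : 'rV[R]_(1 + n) -> R), 0 <= M -> Cc M f ->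
  Cc M (fun t : R => integral_Rn (fun y : 'rV[R]_n => f (row_mx t%:M y))).
Proof.
move=> bn ln M f M0 cf; split; last first.
  move=> t Mt; apply/eqP; rewrite -normr_le0.
  rewrite (le_trans (bn M 0 _ M0 (Cc_slice t cf) _))// ?mul0r// => y.
  by rewrite cf.2 ?normr0// (lt_le_trans Mt)// norm_row_cons_l.
move=> t; apply/continuousP_eps => e e0.
have K0 : 0 <= (2 * M) ^+ n by rewrite exprn_ge0// mulr_ge0.
(* The added 1 keeps the denominator positive when [M = 0]. *)
pose e' := e / ((2 * M) ^+ n + 1).
have e'0 : 0 < e' by rewrite divr_gt0// ltr_wpDl.
have [d d0 H] := Cc_unif_continuous (@rV_compact_ball R _) cf e'0.
exists d => // s ts; rewrite addrC -mulN1r -(ln M)//; try exact: Cc_slice.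
have B : forall y : 'rV[R]_n, `|-1 * f (row_mx s%:M y) + f (row_mx t%:M y)| <= e'.
  move=> y; rewrite mulN1r addrC ltW// H// row_consB subrr.
  by rewrite (le_lt_trans (norm_row_cons_le _ _))// normr0 addr0.
apply: le_lt_trans (bn M e' _ M0 _ B) _.
  by apply: CcZD; exact: Cc_slice.
rewrite /e' mulrAC ltr_pdivrMr; last by rewrite ltr_wpDl.
by rewrite ltr_pM2l// ltrDl.
Qed.

Lemma integral_Rn_bounded_linear n : integral_bounded n /\ integral_linear n.
Proof.
elim: n => [|n [bn ln]].
  by split => [M e f M0 cf fe|M a f g M0 cf cg] //=; rewrite expr0 mulr1.
split => [M e f M0 cf fe|M a f g M0 cf cg].
  rewrite exprSr mulrA; apply: (Cc_Rintegral_le M0 (Cc_slice_integral bn ln M0 cf)).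
  by move=> t; apply: bn => //; exact: Cc_slice.
rewrite /=; pose J f := (fun t : R => integral_Rn (fun y : 'rV[R]_n => f (row_mx t%:M y))).
have cJ f' : Cc M f' -> Cc M (J f') by move=> h; apply: Cc_slice_integral.
rewrite (_ : (fun t : R => _) = (fun t => a * J f t + J g t)); last first.
  by apply/funext => t; rewrite (ln M)//; exact: Cc_slice.
have iJ := Cc_integrable (cJ _ cf).
have iaJ : (@lebesgue_measure R).-integrable setT (EFin \o (fun t => a * J f t)).
  apply: (@Cc_integrable R M); case: (cJ _ cf) => c0 J0; split.
    by move=> x; apply: (@cvgM R); [exact: cvg_cst|exact: c0].
  by move=> x Mx; rewrite J0// mulr0.
by rewrite RintegralD// ?RintegralZl//; exact: Cc_integrable (cJ _ cg).
Qed.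

Lemma integral_Rn_le n (M e : R) (f : 'rV[R]_n -> R) : 0 <= M -> Cc M f ->
  (forall x, `|f x| <= e) -> `|integral_Rn f| <= e * (2 * M) ^+ n.
Proof. by case: (integral_Rn_bounded_linear n) => + _; apply. Qed.

Lemma integral_RnZD n (M a : R) (f g : 'rV[R]_n -> R) : 0 <= M ->
  Cc M f -> Cc M g ->
  integral_Rn (fun x => a * f x + g x) = a * integral_Rn f + integral_Rn g.
Proof. by case: (integral_Rn_bounded_linear n) => _; apply. Qed.

Lemma integral_Rn_slice n (M : R) (f : 'rV[R]_(1 + n) -> R) : 0 <= M -> Cc M f ->
  Cc M (fun t : R => integral_Rn (fun y : 'rV[R]_n => f (row_mx t%:M y))).
Proof. by case: (integral_Rn_bounded_linear n) => ? ?; exact: Cc_slice_integral. Qed.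

Lemma integral_Rn_ge0 n (f : 'rV[R]_n -> R) : (forall x, 0 <= f x) ->
  0 <= integral_Rn f.
Proof.
elim: n f => [|n IH] f f0 /=; first exact: f0.
by apply: Rintegral_ge0 => t _; apply: IH => y; exact: f0.
Qed.

Lemma integral_Rn_gt0 n (M : R) (f : 'rV[R]_n -> R) x : 0 <= M -> Cc M f ->
  (forall x, 0 <= f x) -> 0 < f x -> 0 < integral_Rn f.
Proof.
move=> M0; elim: n f x => [|n IH] f x cf f0 fx /=.
  by rewrite (_ : 0 = x)//; apply/rowP => -[].
have [t [y xE]] := row_cons_ex x.
apply: (Cc_Rintegral_gt0 (x0 := t) (integral_Rn_slice M0 cf)).
  by move=> s; apply: integral_Rn_ge0 => z; exact: f0.
by apply: (IH _ y (Cc_slice t cf)) => //; rewrite -xE.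
Qed.

(** The first coordinate is shifted by the one-dimensional result for the slice integral, the others
    by induction inside each slice. *)
Lemma integral_Rn_shift n (M : R) (f : 'rV[R]_n -> R) a : 0 <= M -> Cc M f ->
  integral_Rn (fun x => f (x + a)) = integral_Rn f.
Proof.
move=> M0; elim: n f a => [|n IH] f a cf /=.
  by congr f; apply/rowP => -[].
have [t [y ->]] := row_cons_ex a.
rewrite -(Cc_Rintegral_shift t (integral_Rn_slice M0 cf)).
apply: eq_Rintegral => s _; rewrite -(IH _ y (Cc_slice _ cf)).
by congr integral_Rn; apply/funext => z; rewrite row_consD.
Qed.

End IntegralRn.

(** * Partial derivatives and integration by parts *)

Section Directional.
Context {R : realType} {V : normedModType R}.
Implicit Types (f : V -> R) (x v a : V).

Lemma derive_quotient_line f x v t :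
  (fun h : R => h^-1 *: (((fun s : R => f (x + s *: v)) \o shift t) (h *: 1) -
     f (x + t *: v))) =
  (fun h => h^-1 *: ((f \o shift (x + t *: v)) (h *: v) - f (x + t *: v))).
Proof.
apply/funext => h; congr (_ *: (f _ - _)); rewrite /= scalerDl addrC -addrA.
by rewrite [h%:A]mulr1; congr (_ + _); rewrite addrC.
Qed.

Lemma is_derive_line f x v t : derivable f (x + t *: v) v ->
  is_derive t 1 (fun s : R => f (x + s *: v)) ('D_v f (x + t *: v)).
Proof.
by move=> df; apply: DeriveDef; rewrite /derivable /derive derive_quotient_line.
Qed.

Lemma MVT_dir f x v (t : R) : (forall s, derivable f (x + s *: v) v) ->
  exists2 s, `|s| <= `|t| & f (x + t *: v) - f x = t * 'D_v f (x + s *: v).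
Proof.
move=> df; pose phi := fun s : R => f (x + s *: v).
have dphi (s : R) : is_derive s 1 phi ('D_v f (x + s *: v)) by exact: is_derive_line.
have cphi : continuous phi.
  move=> s; apply: (@differentiable_continuous R R R^o).
  by apply/derivable1_diffP; case: (dphi s).
have [t0|t0|->] := ltgtP t 0; last first.
- by exists 0; rewrite // scale0r addr0 subrr mul0r.
- have [s + E] := MVT t0 (fun s _ => dphi s) (continuous_subspaceT cphi).
  rewrite in_itv /= => /andP[s0 st]; exists s.
    by rewrite !gtr0_norm// ltW.
  by move: E; rewrite /phi scale0r addr0 subr0 mulrC.
have [s + E] := MVT t0 (fun s _ => dphi s) (continuous_subspaceT cphi).
rewrite in_itv /= => /andP[st s0]; exists s.
  by rewrite !ltr0_norm// lerN2 ltW.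
by move: E; rewrite /phi scale0r addr0 sub0r => /(congr1 -%R); rewrite opprB mulrN opprK mulrC.
Qed.

Lemma derive_quotient_shift f x v a :
  (fun h : R => h^-1 *: (((fun y => f (y + a)) \o shift x) (h *: v) - f (x + a))) =
  (fun h => h^-1 *: ((f \o shift (x + a)) (h *: v) - f (x + a))).
Proof. by apply/funext => h; rewrite /= addrA. Qed.

Lemma derive_translate f x v a : 'D_v (fun y => f (y + a)) x = 'D_v f (x + a).
Proof. by rewrite /derive derive_quotient_shift. Qed.

Lemma derive_eq0_near f x v : (\forall y \near x, f y = 0) -> 'D_v f x = 0.
Proof.
move=> f0; have [->|v0] := eqVneq v 0; first by rewrite derive0.
rewrite (near_eq_derive (g := cst 0)) ?derive_cst//.
Qed.

Lemma derivable_eq0_near f x v : (\forall y \near x, f y = 0) -> derivable f x v.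
Proof.
move=> f0; apply: (near_eq_derivable (f := cst 0)) => //.
by near=> y; rewrite /=; apply/esym; near: y.
Unshelve. all: by end_near. Qed.

End Directional.

Section PartialIntegral.
Context {R : realType}.

Lemma norm_delta_le n (i : 'I_n) : `|delta_mx 0 i : 'rV[R]_n| <= 1.
Proof.
apply: rV_norm_le => // j; rewrite mxE eqxx /=.
by case: eqP; rewrite ?normr1 ?normr0.
Qed.

Lemma Cc_near0 (V : normedModType R) M (f : V -> R) x : Cc M f -> M < `|x| ->
  \forall y \near x, f y = 0.
Proof.
move=> [_ f0] Mx; have : \forall y \near x, M < `|y|.
  by apply: (@norm_continuous _ V x [set r | M < r]); exact: lt_nbhsr.
by apply: filterS => y; exact: f0.
Qed.

(** Class C^1 along coordinate directions only, which is all that integration by parts uses;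
    continuity of [f] is put in rather than derived from the partials. *)
Definition partial_C1 n (f : 'rV[R]_n -> R) : Prop := continuous f /\
  forall i, (forall x, derivable f x (delta_mx 0 i)) /\ continuous (partial i f).

Lemma Cc_partial n M (f : 'rV[R]_n -> R) i : Cc M f -> continuous (partial i f) ->
  Cc M (partial i f).
Proof.
move=> cf cdf; split=> // x Mx; apply: derive_eq0_near; exact: Cc_near0 cf Mx.
Qed.

Lemma Cc_widen (V : normedModType R) M N (f : V -> R) : M <= N -> Cc M f -> Cc N f.
Proof. by move=> MN [cf f0]; split=> // x Nx; apply: f0; exact: le_lt_trans Nx. Qed.

Lemma CcM (V : normedModType R) M (f g : V -> R) : continuous f -> Cc M g ->
  Cc M (fun x => f x * g x).
Proof.
move=> cf [cg g0]; split=> [x|x Mx]; last by rewrite g0// mulr0.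
by apply: (@cvgM R); [exact: cf|exact: cg].
Qed.

Lemma CcD (V : normedModType R) M (f g : V -> R) : Cc M f -> Cc M g ->
  Cc M (fun x => f x + g x).
Proof.
move=> cf cg; rewrite (_ : (fun x => _) = (fun x => 1 * f x + g x)).
  exact: CcZD.
by apply/funext => x; rewrite mul1r.
Qed.

Lemma continuous_sum (T : topologicalType) n (f : 'I_n -> T -> R) :
  (forall i, continuous (f i)) -> continuous (fun x => \sum_i f i x).
Proof.
by move=> H; apply: continuous_big => [|i _]; [exact: (@add_continuous R^o)|exact: H].
Qed.

Lemma Cc_sum (V : normedModType R) M n (f : 'I_n -> V -> R) :
  (forall i, Cc M (f i)) -> Cc M (fun x => \sum_i f i x).
Proof.
move=> H; split; first by apply: continuous_sum => i; case: (H i).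
by move=> x Mx; rewrite big1// => i _; case: (H i) => _; apply.
Qed.

Lemma Cc_shift n M (f : 'rV[R]_n -> R) a : Cc M f -> Cc (M + `|a|) (fun x => f (x + a)).
Proof.
move=> [cf f0]; split=> [x|x Mx].
  apply/continuousP_eps => e e0.
  have [d d0 H] := (continuousP_eps f _).1 (cf (x + a)) _ e0.
  by exists d => // y xy; apply: H; rewrite opprD addrACA subrr addr0.
apply: f0; have : `|x| <= `|x + a| + `|a| by rewrite -{1}(addrK a x) ler_normB.
lra.
Qed.

Lemma integral_Rn0 n : integral_Rn (fun _ : 'rV[R]_n => 0 : R) = 0.
Proof.
have c0 : Cc 0 (fun _ : 'rV[R]_n => 0 : R) by split=> [x|x _] //; exact: cst_continuous.
apply/eqP; rewrite -normr_le0 -[leRHS](mul0r ((2 * 0) ^+ n)).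
by apply: integral_Rn_le => // x; rewrite normr0.
Qed.

Lemma integral_RnD n M (f g : 'rV[R]_n -> R) : 0 <= M -> Cc M f -> Cc M g ->
  integral_Rn (fun x => f x + g x) = integral_Rn f + integral_Rn g.
Proof.
move=> M0 cf cg; rewrite -[X in _ = X + _]mul1r -(integral_RnZD _ M0 cf cg).
by congr integral_Rn; apply/funext => x; rewrite mul1r.
Qed.

Lemma integral_RnZ n M a (f : 'rV[R]_n -> R) : 0 <= M -> Cc M f ->
  integral_Rn (fun x => a * f x) = a * integral_Rn f.
Proof.
move=> M0 cf; have c0 : Cc M (fun _ : 'rV[R]_n => 0 : R).
  by split=> [x|x _] //; exact: cst_continuous.
rewrite -[RHS]addr0 -[X in _ = _ + X](integral_Rn0 n) -(integral_RnZD _ M0 cf c0).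
by congr integral_Rn; apply/funext => x; rewrite addr0.
Qed.

Lemma integral_RnB n M (f g : 'rV[R]_n -> R) : 0 <= M -> Cc M f -> Cc M g ->
  integral_Rn (fun x => f x - g x) = integral_Rn f - integral_Rn g.
Proof.
move=> M0 cf cg; rewrite addrC -mulN1r -(integral_RnZD _ M0 cg cf).
by congr integral_Rn; apply/funext => x; rewrite mulN1r addrC.
Qed.

Lemma CcB (V : normedModType R) M (f g : V -> R) : Cc M f -> Cc M g ->
  Cc M (fun x => f x - g x).
Proof.
move=> cf cg; rewrite (_ : (fun x => _) = (fun x => -1 * g x + f x)).
  exact: CcZD.
by apply/funext => x; rewrite mulN1r addrC.
Qed.

Lemma integral_Rn_dist n M e (f g : 'rV[R]_n -> R) : 0 <= M -> Cc M f -> Cc M g ->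
  (forall x, `|f x - g x| <= e) ->
  `|integral_Rn f - integral_Rn g| <= e * (2 * M) ^+ n.
Proof.
by move=> M0 cf cg H; rewrite -(integral_RnB M0 cf cg) integral_Rn_le//; exact: CcB.
Qed.

Lemma integral_Rn_sum n m M (f : 'I_m -> 'rV[R]_n -> R) : 0 <= M ->
  (forall i, Cc M (f i)) ->
  integral_Rn (fun x => \sum_i f i x) = \sum_i integral_Rn (f i).
Proof.
move=> M0; elim: m f => [|m IH] f cf.
  rewrite big_ord0 -[RHS](integral_Rn0 n).
  by congr integral_Rn; apply/funext => x; rewrite big_ord0.
rewrite big_ord_recl -IH// -(integral_RnD M0)//; last exact: Cc_sum.
by congr integral_Rn; apply/funext => x; rewrite big_ord_recl.
Qed.

Lemma le_integral_Rn n M (f g : 'rV[R]_n -> R) : 0 <= M -> Cc M f -> Cc M g ->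
  (forall x, f x <= g x) -> integral_Rn f <= integral_Rn g.
Proof.
move=> M0 cf cg fg; rewrite -subr_ge0 -(integral_RnB M0 cg cf).
by apply: integral_Rn_ge0 => x; rewrite subr_ge0.
Qed.

Lemma small_eq0 (x C : R) : (forall e, 0 < e -> `|x| <= e * C) -> x = 0.
Proof.
move=> H; apply/eqP; rewrite -normr_le0; apply/ler_addgt0Pr => e e0; rewrite add0r.
have C0 : 0 < `|C| + 1 by rewrite ltr_wpDl.
apply: (le_trans (H (e / (`|C| + 1)) _)); first by rewrite divr_gt0.
rewrite mulrAC ler_pdivrMr// ler_pM2l//.
by rewrite (le_trans (ler_norm _))// lerDl.
Qed.

(* The difference quotients of [f] have integral 0 by translation invariance and
   converge uniformly; this avoids Fubini for the iterated integral. *)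
Lemma integral_Rn_partial n M (f : 'rV[R]_n -> R) i : 0 <= M -> Cc M f ->
  (forall x, derivable f x (delta_mx 0 i)) -> continuous (partial i f) ->
  integral_Rn (partial i f) = 0.
Proof.
move=> M0 cf df cdf; have cp := Cc_partial cf cdf.
have M1 : 0 <= M + 1 by rewrite addr_ge0.
apply: (@small_eq0 _ ((2 * (M + 1)) ^+ n)) => e e0.
have [d d0 H] := Cc_unif_continuous (@rV_compact_ball R _) cp e0.
(* [t < d] brings the difference quotient within [e] of the derivative, and [t <= 1] keeps the
   shifted support within radius [M + 1]. *)
pose t := Num.min (d / 2) 1.
have t0 : 0 < t by rewrite lt_min divr_gt0// ltr01.
have t1 : t <= 1 by rewrite ge_min lexx orbT.
have td : t < d by rewrite gt_min ltr_pdivrMr// ltr_pMr// ltr1n.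
have nt : `|t *: delta_mx 0 i : 'rV[R]_n| <= t.
  by rewrite normrZ gtr0_norm// ler_piMr ?norm_delta_le// ltW.
have cf1 : Cc (M + 1) f by apply: Cc_widen cf; rewrite lerDl.
have cft : Cc (M + 1) (fun x => f (x + t *: delta_mx 0 i)).
  by apply: Cc_widen (Cc_shift _ cf); rewrite lerD2l (le_trans nt).
have cq : Cc (M + 1) (fun x => t^-1 * (f (x + t *: delta_mx 0 i) - f x)).
  by apply: CcM; [exact: cst_continuous|exact: CcB].
have q0 : integral_Rn (fun x => t^-1 * (f (x + t *: delta_mx 0 i) - f x)) = 0.
  rewrite (integral_RnZ _ M1) ?(integral_RnB M1)//; last exact: CcB.
  by rewrite (integral_Rn_shift _ M0)// subrr mulr0.
rewrite -[X in `|X|]subr0 -q0; apply: integral_Rn_dist => //.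
  by apply: Cc_widen cp; rewrite lerDl.
move=> x; have [s st ->] := @MVT_dir R _ f x (delta_mx 0 i) t (fun s => df _).
rewrite mulrA mulVf ?gt_eqF// mul1r ltW// /partial H//.
rewrite opprD addrA subrr sub0r normrN normrZ (le_lt_trans _ td)//.
apply: (@le_trans _ _ `|s|); first by rewrite ler_piMr ?norm_delta_le.
by rewrite (le_trans st)// gtr0_norm.
Qed.

End PartialIntegral.

(** * Mollification *)

Section Mollification.
Context {R : realType} {n : nat}.
Local Notation V := 'rV[R]_n.
Implicit Types (F G k f : V -> R) (x y : V).

(** Convolution with the reflected kernel. The order [y - x] makes the factor of [F] literally a
    translate of [k], hence an admissible test function, at the price of a sign when differentiating
    in [x]. *)
Definition correlation F k x : R := integral_Rn (fun y => F y * k (y - x)).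

Lemma Cc_correlation F k M N x : continuous F -> Cc M k -> `|x| <= N ->
  Cc (M + N) (fun y => F y * k (y - x)).
Proof.
move=> cF ck xN; apply: CcM => //; apply: Cc_widen (Cc_shift (- x) ck).
by rewrite lerD2l normrN.
Qed.

(** [F] may be unbounded at infinity: only its bound on the ball of radius [N], where [a] and [b]
    live, enters [C]. *)
Lemma integral_Rn_mul_dist F N : continuous F -> 0 <= N ->
  exists2 C, 0 < C & forall (a b : V -> R) e, 0 <= e -> Cc N a -> Cc N b ->
    (forall y, `|a y - b y| <= e) ->
    `|integral_Rn (fun y => F y * a y) - integral_Rn (fun y => F y * b y)| <= e * C.
Proof.
move=> cF N0.
have [B B0 HB] : exists2 B, 0 < B & forall y, `|y| <= N -> `|F y| <= B.
  have : compact (F @` [set x | `|x| <= N]).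
    apply: continuous_compact; last exact: rV_compact_ball.
    exact: continuous_subspaceT.
  move=> /compact_bounded[B [_ HB]].
  exists (Num.max (B + 1) 1); first by rewrite lt_max ltr01 orbT.
  move=> y yN; rewrite le_max; apply/orP; left.
  by apply: (HB (B + 1)); [rewrite ltrDl|exists y].
exists (B * (2 * N) ^+ n + 1).
  by rewrite ltr_wpDl// mulr_ge0 ?exprn_ge0 ?mulr_ge0// ltW.
move=> a b e e0 ca cb ab.
apply: (@le_trans _ _ ((e * B) * (2 * N) ^+ n)); last first.
  by rewrite -mulrA ler_wpM2l// lerDl.
apply: integral_Rn_dist => //; [exact: CcM|exact: CcM|move=> y].
rewrite -mulrBr normrM mulrC; have [yN|Ny] := leP `|y| N.
  by rewrite ler_pM// HB.
by rewrite ca.2// cb.2// subrr normr0 mul0r mulr_ge0// ltW.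
Qed.

Lemma continuous_correlation F k M : 0 <= M -> continuous F -> Cc M k ->
  continuous (correlation F k).
Proof.
move=> M0 cF ck x; apply/continuousP_eps => e e0.
(* This radius contains the supports of all translates of [k] by points within distance 1 of [x]. *)
have N0 : 0 <= M + (`|x| + 1) by rewrite !addr_ge0.
have [C C0 H] := integral_Rn_mul_dist cF N0.
have eC : 0 < e / (C * 2) by rewrite divr_gt0// mulr_gt0.
have [d d0 Hd] := Cc_unif_continuous (@rV_compact_ball R _) ck eC.
exists (Num.min d 1); first by rewrite lt_min d0 ltr01.
move=> x'; rewrite lt_min => /andP[xd x1].
have x'N : `|x'| <= `|x| + 1.
  rewrite -(subKr x x') (le_trans (ler_normB _ _))// lerD2l; exact: ltW.
apply: (le_lt_trans (H _ _ _ (ltW eC) _ _ _)).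
- by apply: Cc_widen (Cc_shift (- x) ck); rewrite normrN lerD2l lerDl.
- by apply: Cc_widen (Cc_shift (- x') ck); rewrite normrN lerD2l.
- move=> y; apply/ltW/Hd.
  by rewrite opprB addrC addrA subrK distrC.
have -> : e / (C * 2) * C = e / 2 by field; rewrite gt_eqF.
by rewrite ltr_pdivrMr// ltr_pMr// ltr1n.
Qed.

(** The derivative falls on the kernel, because the difference quotients of [k] converge uniformly
    with supports in one ball; [F] is merely continuous. *)
Lemma partial_correlation F k M i x : 0 <= M -> continuous F -> Cc M k ->
    partial_C1 k ->
  derivable (correlation F k) x (delta_mx 0 i) /\
  partial i (correlation F k) x = - correlation F (partial i k) x.
Proof.
move=> M0 cF ck [_ /(_ i)[dk cdk]].
have cpk := Cc_partial ck cdk.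
suff H : (fun h : R => h^-1 *: ((correlation F k \o shift x) (h *: delta_mx 0 i)
    - correlation F k x)) @ 0^' --> - correlation F (partial i k) x.
  by split; [exact: cvgP H|exact: (cvg_lim _ H)].
apply/cvgrPdist_lt => e e0.
have N0 : 0 <= M + (`|x| + 1) by rewrite !addr_ge0.
have [C C0 H] := integral_Rn_mul_dist cF N0.
have eC : 0 < e / (C * 2) by rewrite divr_gt0// mulr_gt0.
have [d d0 Hd] := Cc_unif_continuous (@rV_compact_ball R _) cpk eC.
exists (Num.min d 1) => /=; first by rewrite lt_min d0 ltr01.
move=> h /=; rewrite sub0r normrN lt_min => /andP[hd h1] h0.
have nhe : `|h *: delta_mx 0 i : V| <= `|h|.
  by rewrite normrZ ler_piMr// norm_delta_le.
pose a y := h^-1 * (k (y - (h *: delta_mx 0 i + x)) - k (y - x)).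
pose b y := -1 * partial i k (y - x).
have ck1 : Cc (M + (`|x| + 1)) (fun y => k (y - x)).
  by apply: Cc_widen (Cc_shift (- x) ck); rewrite normrN lerD2l lerDl.
have ck2 : Cc (M + (`|x| + 1)) (fun y => k (y - (h *: delta_mx 0 i + x))).
  apply: Cc_widen (Cc_shift (- (h *: delta_mx 0 i + x)) ck).
  rewrite normrN lerD2l (le_trans (ler_normD _ _))// addrC lerD2l.
  by rewrite (le_trans nhe)// ltW.
have ca : Cc (M + (`|x| + 1)) a.
  by apply: CcM; [exact: cst_continuous|exact: CcB].
have cb : Cc (M + (`|x| + 1)) b.
  apply: CcM; first exact: cst_continuous.
  by apply: Cc_widen (Cc_shift (- x) cpk); rewrite normrN lerD2l lerDl.
have -> : - correlation F (partial i k) x = integral_Rn (fun y => F y * b y).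
  rewrite -mulN1r -(integral_RnZ _ N0).
    by congr integral_Rn; apply/funext => y; rewrite /b mulrCA.
  by apply: Cc_correlation cpk _ => //; rewrite lerDl.
have -> : h^-1 *: (correlation F k (h *: delta_mx 0 i + x) - correlation F k x)
    = integral_Rn (fun y => F y * a y).
  rewrite -(integral_RnB N0); try exact: CcM.
  rewrite -[LHS](integral_RnZ _ N0); last by apply: CcB; exact: CcM.
  by congr integral_Rn; apply/funext => y; rewrite /a -mulrBr mulrCA.
apply: (le_lt_trans (H _ _ _ (ltW eC) cb ca _)).
  move=> y; rewrite /a /b.
  (* The kernel is evaluated at [y - x] displaced by [- h] along the coordinate direction; this is
     the sign in [b]. *)
  have [s sh] := @MVT_dir R _ k (y - x) (delta_mx 0 i) (- h) (fun s => dk _).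
  rewrite (_ : y - x + - h *: _ = y - (h *: delta_mx 0 i + x)); last first.
    by rewrite scaleNr opprD -addrA [- x - _]addrC.
  move=> ->; rewrite mulrA mulrN mulVf// -mulrBr mulN1r normrN ltW// Hd//.
  rewrite opprD addrA subrr sub0r normrN normrZ (le_lt_trans _ hd)//.
  rewrite normrN in sh; apply: (@le_trans _ _ `|s|) => //.
  by rewrite ler_piMr// norm_delta_le.
have -> : e / (C * 2) * C = e / 2 by field; rewrite gt_eqF.
by rewrite ltr_pdivrMr// ltr_pMr// ltr1n.
Qed.

(** The kernel is not normalised, so its mass stays as a factor. On the support of the translated
    kernel [F y - F x] lies between [- d] and [d], and integrating against the nonnegative kernel
    keeps these bounds. *)
Lemma correlation_approx F k r d x : 0 <= r -> continuous F -> Cc r k ->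
  (forall y, 0 <= k y) -> (forall y, `|y - x| <= r -> `|F y - F x| <= d) ->
  `|correlation F k x - F x * integral_Rn k| <= d * integral_Rn k.
Proof.
move=> r0 cF ck k0 Fd.
have N0 : 0 <= r + `|x| by rewrite addr_ge0.
have ckx : Cc (r + `|x|) (fun y => k (y - x)).
  by apply: Cc_widen (Cc_shift (- x) ck); rewrite normrN.
have Ec c : c * integral_Rn k = integral_Rn (fun y => c * k (y - x)).
  by rewrite (integral_RnZ _ N0)// (integral_Rn_shift _ r0).
have cc c : Cc (r + `|x|) (fun y => c * k (y - x)).
  by apply: CcM => //; exact: cst_continuous.
have cFk : Cc (r + `|x|) (fun y => F y * k (y - x)) by exact: CcM.
rewrite !Ec -(integral_RnB N0)// ler_norml; apply/andP; split.
  rewrite -mulN1r -(integral_RnZ _ N0)//; apply: (le_integral_Rn N0).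
  - by apply: CcM => //; exact: cst_continuous.
  - exact: CcB.
  move=> y; rewrite mulrA mulN1r -mulrBl; have [yr|ry] := leP `|y - x| r.
    by rewrite ler_wpM2r//; move: (Fd _ yr); rewrite ler_norml => /andP[].
  by rewrite ck.2// !mulr0.
apply: (le_integral_Rn N0) => //; first exact: CcB.
move=> y; rewrite -mulrBl; have [yr|ry] := leP `|y - x| r.
  by rewrite ler_wpM2r//; move: (Fd _ yr); rewrite ler_norml => /andP[].
by rewrite ck.2// !mulr0.
Qed.

Lemma partial_C1M f g i x : derivable f x (delta_mx 0 i) -> derivable g x (delta_mx 0 i) ->
  partial i (fun y => f y * g y) x = f x * partial i g x + g x * partial i f x.
Proof. by move=> df dg; rewrite /partial (deriveM df dg). Qed.

(* The mollified field is C^1, and testing its weak divergence against the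
   translates of the mollifier computes its divergence. *)
Lemma mollified_integral (F : 'I_n -> V -> R) G k (M r : R) (psi : V -> R) :
  0 <= r -> 0 <= M -> (forall i, continuous (F i)) -> continuous G ->
  Cc r k -> partial_C1 k ->
  (forall a, - integral_Rn (fun y => \sum_i F i y * partial i (fun z => k (z - a)) y)
     = integral_Rn (fun y => G y * k (y - a))) ->
  Cc M psi -> partial_C1 psi ->
  integral_Rn (fun x => \sum_i correlation (F i) k x * partial i psi x
     + correlation G k x * psi x) = 0.
Proof.
move=> r0 M0 cF cG ck dk HF cpsi dpsi.
have dcF i x j := @partial_correlation (F i) k r j x r0 (cF i) ck dk.
have ccF i := @continuous_correlation (F i) k r r0 (cF i) ck.
(* Moving the derivative from [x] to [y] costs a sign, exactly the one in the weak identity tested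
   with a translate of [k]. *)
have divE x : \sum_i partial i (correlation (F i) k) x = correlation G k x.
  rewrite [RHS]/correlation -HF (eq_bigr _ (fun i _ => (dcF i x i).2)) sumrN.
  have N0 : 0 <= r + `|x| by rewrite addr_ge0.
  rewrite -(integral_Rn_sum N0) => [|i]; last first.
    apply: Cc_correlation => //; apply: Cc_partial => //; exact: (dk.2 i).2.
  congr (- _); congr integral_Rn; apply/funext => y.
  by apply: eq_bigr => i _; rewrite /partial derive_translate.
have cdpsi i : continuous (partial i psi) by exact: (dpsi.2 i).2.
have cpk i : continuous (partial i (correlation (F i) k)).
  rewrite (_ : partial i _ = (fun x => -1 * correlation (F i) (partial i k) x)); last first.
    by apply/funext => x; rewrite (dcF i x i).2 mulN1r.
  move=> x; apply: continuous_at_mul; [exact: continuous_at_cst|move: x].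
  apply: (continuous_correlation r0) => //; apply: Cc_partial => //.
  exact: (dk.2 i).2.
(* By the product rule the integrand becomes the divergence of [psi] times the mollified field, and
   each partial derivative of a compactly supported function integrates to 0. *)
pose g i x := correlation (F i) k x * partial i psi x + psi x * partial i (correlation (F i) k) x.
have gE i : g i = partial i (fun x => correlation (F i) k x * psi x).
  apply/funext => x; rewrite partial_C1M//; first by case: (dcF i x i).
  exact: (dpsi.2 i).1.
have cg i : Cc M (g i).
  apply: CcD; first by apply: CcM => //; exact: Cc_partial.
  rewrite (_ : (fun x => _) = (fun x => partial i (correlation (F i) k) x * psi x)).
    exact: CcM.
  by apply/funext => x; rewrite mulrC.
rewrite (_ : (fun x => _) = (fun x => \sum_i g i x)); last first.
  apply/funext => x; rewrite /g big_split /= -mulr_sumr divE; congr (_ + _).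
  by rewrite mulrC.
rewrite (integral_Rn_sum M0)// big1// => i _; rewrite gE.
apply: (integral_Rn_partial M0).
- exact: CcM.
- move=> x; apply: derivableM; first by case: (dcF i x i).
  exact: (dpsi.2 i).1.
- by rewrite -gE; case: (cg i).
Qed.

Lemma unif_continuous_family (F : 'I_n -> V -> R) M :
  (forall i, continuous (F i)) -> forall e, 0 < e -> exists2 d, 0 < d &
    forall i x y, `|x| <= M -> `|x - y| < d -> `|F i x - F i y| < e.
Proof.
move=> cF e e0.
have H i : exists d : R, 0 < d /\
    forall x y, `|x| <= M -> `|x - y| < d -> `|F i x - F i y| < e.
  have [d d0 H] := compact_unif_continuous (@rV_compact_ball R n M) (cF i) e0.
  by exists d; split.
have [d Hd] := choice H.
exists (\big[Num.min/1]_i d i).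
  by elim/big_ind: _ => // [u v u0 v0|i _]; [rewrite lt_min u0|case: (Hd i)].
move=> i x y xM xy; apply: (Hd i).2 => //.
by rewrite (lt_le_trans xy)// bigmin_le_cond.
Qed.

(** The identity is exact for the mollified fields. As the radius of the kernel shrinks, these
    approach the mass of the kernel times [F] and [G], uniformly on the support of [psi] relative to
    that mass. *)
Lemma weak_divergence_C1 (F : 'I_n -> V -> R) G (psi : V -> R) (M : R) :
  (forall r : R, 0 < r -> exists k, [/\ Cc r k, partial_C1 k, forall y, 0 <= k y, 0 < k 0 &
     forall a, - integral_Rn (fun y => \sum_i F i y * partial i (fun z => k (z - a)) y)
     = integral_Rn (fun y => G y * k (y - a))]) ->
  (forall i, continuous (F i)) -> continuous G ->
  0 <= M -> Cc M psi -> partial_C1 psi ->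
  integral_Rn (fun x => \sum_i F i x * partial i psi x + G x * psi x) = 0.
Proof.
move=> Hk cF cG M0 cpsi dpsi.
have cdpsi i : Cc M (partial i psi) by apply: Cc_partial => //; exact: (dpsi.2 i).2.
have [B B0 HB] := Cc_bounded (@rV_compact_ball R _) cpsi.
have HB'0 i := Cc_bounded (@rV_compact_ball R _) (cdpsi i).
have HB'1 i : exists B' : R, 0 < B' /\ forall x, `|partial i psi x| <= B'.
  by have [B' ? ?] := HB'0 i; exists B'.
have {HB'0 HB'1}[B' HB'] := choice HB'1.
apply: (@small_eq0 _ _ ((\sum_i B' i + B) * (2 * M) ^+ n)) => e e0.
have [d1 d10 Hd1] := @unif_continuous_family F M cF e e0.
have [d2 d20 Hd2] := compact_unif_continuous (@rV_compact_ball R n M) cG e0.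
pose r := Num.min d1 d2 / 2.
have r0 : 0 < r by rewrite divr_gt0// lt_min d10.
have rd : r < Num.min d1 d2 by rewrite ltr_pdivrMr ?ltr_pMr ?ltr1n// lt_min d10.
have [k [ck dk k0 k00 Hweak]] := Hk r r0.
have Z0 : 0 < integral_Rn k := integral_Rn_gt0 (ltW r0) ck k0 k00.
(* Multiplying the claim by the mass of the kernel replaces normalising the kernel. *)
rewrite -(ler_pM2l Z0) -{1}(gtr0_norm Z0) -normrM.
have cI : Cc M (fun x => \sum_i F i x * partial i psi x + G x * psi x).
  by apply: CcD; [apply: Cc_sum => i; exact: CcM|exact: CcM].
have N0 x : `|x| <= M -> forall y, `|y - x| <= r ->
    (forall i, `|F i y - F i x| <= e) /\ `|G y - G x| <= e.
  move=> xM y yr; have := le_lt_trans yr rd; rewrite lt_min => /andP[y1 y2].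
  by split=> [i|]; rewrite distrC ltW//; [apply: Hd1|apply: Hd2]; rewrite // distrC.
have cF' i := continuous_correlation (ltW r0) (cF i) ck.
have cG' := continuous_correlation (ltW r0) cG ck.
rewrite -(integral_RnZ _ M0)// -[X in `|X|]subr0.
rewrite -[X in `|_ - X|](mollified_integral (ltW r0) M0 cF cG ck dk Hweak cpsi dpsi).
have -> : integral_Rn k * (e * ((\sum_i B' i + B) * (2 * M) ^+ n)) =
    integral_Rn k * (e * (\sum_i B' i + B)) * (2 * M) ^+ n by rewrite !mulrA.
apply: integral_Rn_dist => //.
- by apply: CcM => //; exact: cst_continuous.
- by apply: CcD; [apply: Cc_sum => i; exact: CcM|exact: CcM].
move=> x; rewrite mulrDr mulr_sumr opprD addrACA -sumrB [e * _]mulrDr mulrDr.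
have [xM|Mx] := leP `|x| M; last first.
  rewrite big1 => [|i _]; last by rewrite (cdpsi i).2// !mulr0 subrr.
  rewrite cpsi.2// !mulr0 subrr addr0 normr0.
  rewrite addr_ge0// mulr_ge0 ?mulr_ge0//; try exact: ltW.
  by rewrite sumr_ge0// => i _; exact: ltW (HB' i).1.
have est (H : V -> R) (t T : R) : continuous H -> (forall y, `|y - x| <= r -> `|H y - H x| <= e) ->
    `|t| <= T ->
    `|integral_Rn k * (H x * t) - correlation H k x * t| <= integral_Rn k * (e * T).
  move=> cH He tT; rewrite mulrA -mulrBl normrM mulrA ler_pM//.
  rewrite distrC mulrC [leRHS]mulrC (correlation_approx (ltW r0))//.
rewrite (le_trans (ler_normD _ _))// lerD//; last first.
  by apply: est => // y yr; exact: (N0 x xM y yr).2.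
rewrite (le_trans (ler_norm_sum _ _ _))// !mulr_sumr ler_sum// => i _.
by apply: est => //; [move=> y yr; exact: (N0 x xM y yr).1|exact: (HB' i).2].
Qed.

End Mollification.

Section DeriveRules.
Context {R : realType} {V : normedModType R}.
Implicit Types (f g : V -> R) (x v : V).

Lemma is_derive_add f g x v (a b : R) : is_derive x v f a -> is_derive x v g b ->
  is_derive x v (fun y => f y + g y) (a + b).
Proof. exact: is_deriveD. Qed.

Lemma is_derive_sub f g x v (a b : R) : is_derive x v f a -> is_derive x v g b ->
  is_derive x v (fun y => f y - g y) (a - b).
Proof. exact: is_deriveB. Qed.

Lemma is_derive_mul f g x v (a b : R) : is_derive x v f a -> is_derive x v g b ->
  is_derive x v (fun y => f y * g y) (a * g x + f x * b).
Proof.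
move=> df dg; apply: (is_derive_eq (is_deriveM df dg)).
by rewrite /GRing.scale /= addrC [g x * a]mulrC.
Qed.

Lemma is_derive_mull f x v (c a : R) : is_derive x v f a ->
  is_derive x v (fun y => c * f y) (c * a).
Proof. exact: is_deriveZ. Qed.

Lemma is_derive_const x v (c : R) : is_derive x v (fun _ => c) 0.
Proof. exact: is_derive_cst. Qed.

Lemma is_derive_sumf n (f : 'I_n -> V -> R) x v (a : 'I_n -> R) :
  (forall i, is_derive x v (f i) (a i)) ->
  is_derive x v (fun y => \sum_i f i y) (\sum_i a i).
Proof.
move=> df; have := is_derive_sum df; congr is_derive.
by apply/funext => y; rewrite fct_sumE.
Qed.

(** [f] is only derivable along [v], so the one-variable chain rule is applied at 0 to its
    restriction to the line through [x]. *)
Lemma is_derive_compr (phi : R -> R) f x v (a b : R) :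
  is_derive (f x) 1 phi a -> is_derive x v f b ->
  is_derive x v (fun y => phi (f y)) (a * b).
Proof.
have q0 (F : V -> R) : (fun h : R => h^-1 *:
    (((fun s : R => F (x + s *: v)) \o shift 0) (h *: 1) - F (x + 0 *: v))) =
    (fun h => h^-1 *: ((F \o shift x) (h *: v) - F x)).
  by rewrite derive_quotient_line scale0r addr0.
move=> dphi [df dfE]; pose l (s : R) := f (x + s *: v).
have dl : is_derive (0 : R) 1 l b.
  by apply: DeriveDef; rewrite /derivable /derive q0.
have dphi' : is_derive (l 0) 1 phi a by rewrite /l scale0r addr0.
have [dc <-] := is_derive1_comp dphi' dl.
have E := q0 (fun y => phi (f y)).
apply: DeriveDef; first by rewrite /derivable -E; exact: dc.
by rewrite /derive -E.
Qed.

End DeriveRules.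

Section Coordinates.
Context {R : realType}.

Lemma partialE n (f : 'rV[R]_n -> R) i (x : 'rV[R]_n) (a : R) :
  is_derive x (delta_mx 0 i) f a -> partial i f x = a.
Proof. by case. Qed.

Lemma is_derive_coord n (x : 'rV[R]_n) (v : 'rV[R]_n) i :
  is_derive x v (fun y => y 0 i) (v 0 i).
Proof.
suff H : (fun h : R => h^-1 *: (((fun y : 'rV[R]_n => y 0 i : R) \o shift x) (h *: v) - x 0 i))
    @ 0^' --> v 0 i.
  by apply: DeriveDef; [exact: cvgP H|exact: (cvg_lim _ H)].
apply: (cvg_trans _ (@cvg_cst _ (v 0 i) _ (0^' : set_system R) _)).
apply: near_eq_cvg; near=> h; rewrite /= !mxE addrK /GRing.scale /= mulrA mulVf ?mul1r//.
by near: h; exact: nbhs_dnbhs_neq.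
Unshelve. all: by end_near. Qed.

Definition dot n (a b : 'rV[R]_n) : R := \sum_i a 0 i * b 0 i.
Definition sqn n (a : 'rV[R]_n) : R := \sum_i a 0 i ^+ 2.

Lemma is_derive_sqn n (x v a : 'rV[R]_n) :
  is_derive x v (fun y => sqn (y - a)) (2 * dot v (x - a)).
Proof.
have : is_derive x v (fun y : 'rV[R]_n => \sum_i (y 0 i - a 0 i) * (y 0 i - a 0 i))
   (\sum_i ((v 0 i - 0) * (x 0 i - a 0 i) + (x 0 i - a 0 i) * (v 0 i - 0))).
  apply: is_derive_sumf => i; apply: is_derive_mul; apply: is_derive_sub;
    by [exact: is_derive_coord|exact: is_derive_const].
rewrite (_ : (fun y : 'rV[R]_n => _) = (fun y => sqn (y - a))); last first.
  by apply/funext => y; apply: eq_bigr => i _; rewrite !mxE expr2.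
move=> H; apply: (is_derive_eq H); rewrite /dot mulr_sumr.
by apply: eq_bigr => i _; rewrite !mxE; ring.
Qed.

Lemma dot_delta n (z : 'rV[R]_n) i : dot (delta_mx 0 i) z = z 0 i.
Proof.
rewrite /dot (bigD1 i)//= big1 => [|j ji]; first by rewrite mxE !eqxx mul1r addr0.
by rewrite mxE eqxx (negbTE ji) mul0r.
Qed.

End Coordinates.

(** * Smooth bump functions *)

Section Bump.
Context {R : realType}.

(** The flat function exp(-1/s), with the factors s^(-m) included so that derivatives stay in the
    linear span of the family. *)
Definition exp_bump (m : nat) (s : R) : R :=
  if 0 < s then s^-1 ^+ m * expR (- s^-1) else 0.

Lemma exp_bump_ge0 m s : 0 <= exp_bump m s.
Proof.
rewrite /exp_bump; case: ifP => // s0.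
by rewrite mulr_ge0 ?exprn_ge0 ?invr_ge0 ?expR_ge0 ?ltW.
Qed.

(** The single term u^(m+1)/(m+1)! of the exponential series at u = 1/s beats s^(-m) with a factor s
    to spare. *)
Lemma exp_bump_le m s : 0 < s -> exp_bump m s <= m.+1`!%:R * s.
Proof.
move=> s0; rewrite /exp_bump s0.
have i0 : 0 <= s^-1 by rewrite invr_ge0 ltW.
have F0 : (0 : R) < m.+1`!%:R by rewrite ltr0n fact_gt0.
have H : s^-1 ^+ m.+1 / m.+1`!%:R <= expR s^-1.
  by apply: le_trans (expR_ge1Dxn m i0); rewrite lerDr.
rewrite expRN ler_pdivrMr ?expR_gt0//.
apply: (@le_trans _ _ (m.+1`!%:R * s * (s^-1 ^+ m.+1 / m.+1`!%:R))).
  rewrite exprS (_ : _ * s * _ = s^-1 ^+ m); first by [].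
  by field; rewrite !gt_eqF.
by rewrite ler_wpM2l// mulr_ge0// ltW.
Qed.

Lemma is_derive_exp_bump m (s : R) :
  is_derive s 1 (exp_bump m) (- m%:R * exp_bump m.+1 s + exp_bump m.+2 s).
Proof.
have [s0|s0|->] := ltgtP s 0.
- have E : \near s, cst 0 s = exp_bump m s.
    near=> t; have t0 : t < 0 by near: t; exact: lt_nbhsl.
    by rewrite /exp_bump ltNge (ltW t0).
  apply: (near_eq_is_derive E); apply: (is_derive_eq (is_derive_cst _ _ _)).
  by rewrite /exp_bump !ltNge (ltW s0) /= mulr0 addr0.
- have E : \near s, s^-1 ^+ m * expR (- s^-1) = exp_bump m s.
    near=> t; have t0 : 0 < t by near: t; exact: lt_nbhsr.
    by rewrite /exp_bump t0.
  apply: (near_eq_is_derive E).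
  have dV : is_derive s 1 (fun t : R => t^-1) (- s ^- 2).
    have H := @is_deriveV R id s 1 1 (lt0r_neq0 s0) (is_derive_id _ _).
    by apply: (is_derive_eq H); rewrite /GRing.scale /= mulr1.
  have dX : is_derive s 1 (fun t : R => t^-1 ^+ m) (m%:R * s^-1 ^+ m.-1 * (- s ^- 2)).
    have := is_deriveX m dV; congr is_derive.
    by apply/funext => t; rewrite exprfctE.
  have dN : is_derive s 1 (fun t : R => - t^-1) (s ^- 2).
    by apply: (is_derive_eq (is_deriveN dV)); rewrite opprK.
  have dE := @is_derive_compr R R expR (fun t => - t^-1) s 1 _ _
    (is_derive_expR (- s^-1)) dN.
  apply: (is_derive_eq (is_derive_mul dX dE)); rewrite /exp_bump s0.
  by case: (m) => [|k] /=; rewrite ?exprSr; field; rewrite gt_eqF.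
suff H : (fun h : R => h^-1 *: ((exp_bump m \o shift 0) (h *: 1) - exp_bump m 0)) @ 0^' --> (0 : R).
  apply: DeriveDef; first exact: cvgP H.
  by rewrite /derive (cvg_lim _ H)// /exp_bump ltxx mulr0 addr0.
apply/cvgrPdist_lt => e e0.
have F0 : (0 : R) < m.+2`!%:R by rewrite ltr0n fact_gt0.
exists (e / m.+2`!%:R) => /=; first by rewrite divr_gt0.
move=> h /=; rewrite sub0r normrN => he h0.
rewrite sub0r normrN addr0 [h%:A]mulr1 {2}/exp_bump ltxx subr0 /GRing.scale /=.
have [h_lt|h_gt] := ltP 0 h; last by rewrite /exp_bump (le_gtF h_gt) mulr0 normr0.
have -> : h^-1 * exp_bump m h = exp_bump m.+1 h by rewrite /exp_bump h_lt exprS mulrA.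
rewrite ger0_norm ?exp_bump_ge0// (le_lt_trans (exp_bump_le _ h_lt))//.
by rewrite -ltr_pdivlMl// mulrC -{1}(gtr0_norm h_lt).
Unshelve. all: by end_near. Qed.

End Bump.

Section TestFunctions.
Context {R : realType} {n : nat}.
Local Notation V := 'rV[R]_n.

Lemma sqn_ge0 (x : V) : 0 <= sqn x.
Proof. by apply: sumr_ge0 => i _; exact: sqr_ge0. Qed.

Lemma normr_sqn (x : V) : `|x| ^+ 2 <= sqn x.
Proof.
rewrite -[leRHS]sqr_sqrtr ?sqn_ge0// lerXn2r ?nnegrE ?sqrtr_ge0//.
apply: rV_norm_le => [|i]; first exact: sqrtr_ge0.
rewrite -sqrtr_sqr ler_sqrt ?sqn_ge0// /sqn (bigD1 i)//= lerDl.
by apply: sumr_ge0 => j _; exact: sqr_ge0.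
Qed.

Lemma differentiable_sqn (a x : V) : differentiable (fun y => sqn (y - a)) x.
Proof.
have := @differentiable_sum _ _ _ n (fun i (y : V) => (y 0 i - a 0 i) * (y 0 i - a 0 i)) x _.
rewrite (_ : \sum_(i < n) _ = (fun y => sqn (y - a))); last first.
  by apply/funext => y; rewrite fct_sumE; apply: eq_bigr => i _; rewrite !mxE expr2.
apply=> i; apply: differentiableM; apply: differentiableB;
  by [exact: differentiable_coord|exact: differentiable_cst].
Qed.

(* The test functions lie in this algebra, which is stable under [partial]; hence
   they are smooth. *)
Inductive bump_algebra (a : V) (r : R) : (V -> R) -> Prop :=
| ba_const c : bump_algebra a r (fun _ => c)
| ba_coord i : bump_algebra a r (fun x => x 0 i)
| ba_bump m : bump_algebra a r (fun x => exp_bump m (r ^+ 2 - sqn (x - a)))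
| ba_add f g : bump_algebra a r f -> bump_algebra a r g ->
    bump_algebra a r (fun x => f x + g x)
| ba_mul f g : bump_algebra a r f -> bump_algebra a r g ->
    bump_algebra a r (fun x => f x * g x).

Lemma bump_algebra_differentiable a r f x : bump_algebra a r f -> differentiable f x.
Proof.
elim=> [c|i|m|g h _ dg _ dh|g h _ dg _ dh].
- exact: differentiable_cst.
- exact: differentiable_coord.
- apply: (@differentiable_comp _ _ _ _ (fun y => r ^+ 2 - sqn (y - a)) (exp_bump m)).
    by apply: differentiableB; [exact: differentiable_cst|exact: differentiable_sqn].
  apply/derivable1_diffP; apply: ex_derive; exact: is_derive_exp_bump.
- exact: differentiableD.
- exact: differentiableM.
Qed.

Lemma is_derive_partial (f : V -> R) i x : differentiable f x ->
  is_derive x (delta_mx 0 i) f (partial i f x).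
Proof. by move=> df; apply: DeriveDef => //; exact: diff_derivable. Qed.

Lemma is_derive_bump_sqn m (a : V) r i (x : V) :
  is_derive x (delta_mx 0 i) (fun y => exp_bump m (r ^+ 2 - sqn (y - a)))
   ((- m%:R * exp_bump m.+1 (r ^+ 2 - sqn (x - a)) + exp_bump m.+2 (r ^+ 2 - sqn (x - a)))
     * (- 2 * (x 0 i - a 0 i))).
Proof.
have H := is_derive_sub (is_derive_const x (delta_mx 0 i) (r ^+ 2))
  (is_derive_sqn x (delta_mx 0 i) a).
have := @is_derive_compr R V (exp_bump m) (fun y => r ^+ 2 - sqn (y - a)) x _ _ _
  (is_derive_exp_bump m (r ^+ 2 - sqn (x - a))) H.
by move/is_derive_eq; apply; rewrite dot_delta !mxE; ring.
Qed.

Lemma bump_algebra_partial a r f i : bump_algebra a r f -> bump_algebra a r (partial i f).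
Proof.
elim=> [c|j|m|g h bg pg bh ph|g h bg pg bh ph].
- rewrite (_ : partial i _ = fun _ => 0); first exact: ba_const.
  by apply/funext => x; apply: partialE; exact: is_derive_const.
- rewrite (_ : partial i _ = fun _ => (delta_mx 0 i : V) 0 j); first exact: ba_const.
  by apply/funext => x; apply: partialE; exact: is_derive_coord.
- rewrite (_ : partial i _ = fun x => (- m%:R * exp_bump m.+1 (r ^+ 2 - sqn (x - a)) +
      exp_bump m.+2 (r ^+ 2 - sqn (x - a))) * (- 2 * (x 0 i + (- a 0 i)))).
    apply: ba_mul; [apply: ba_add|apply: ba_mul].
    + by apply: ba_mul; [exact: ba_const|exact: ba_bump].
    + exact: ba_bump.
    + exact: ba_const.
    + by apply: ba_add; [exact: ba_coord|exact: ba_const].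
  by apply/funext => x; apply: partialE; exact: is_derive_bump_sqn.
- rewrite (_ : partial i _ = fun x => partial i g x + partial i h x); first exact: ba_add.
  apply/funext => x; apply: partialE.
  by apply: is_derive_add; apply: is_derive_partial;
    [exact: bump_algebra_differentiable bg|exact: bump_algebra_differentiable bh].
- rewrite (_ : partial i _ = fun x => partial i g x * h x + g x * partial i h x).
    by apply: ba_add; exact: ba_mul.
  apply/funext => x; apply: partialE.
  by apply: is_derive_mul; apply: is_derive_partial;
    [exact: bump_algebra_differentiable bg|exact: bump_algebra_differentiable bh].
Qed.

Lemma bump_algebra_smooth a r f : bump_algebra a r f -> smooth f.
Proof.
move=> bf s x; apply: (@bump_algebra_differentiable a r).
by elim: s => //= i s IH; exact: bump_algebra_partial.
Qed.

Lemma bump_algebra_C1 a r f : bump_algebra a r f -> partial_C1 f.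
Proof.
move=> bf; split=> [x|i].
  by apply: differentiable_continuous; exact: bump_algebra_differentiable bf.
split=> x; first by apply: diff_derivable; exact: bump_algebra_differentiable bf.
apply: differentiable_continuous; apply: bump_algebra_differentiable.
exact: bump_algebra_partial bf.
Qed.

Lemma compact_support_Cc M (f : V -> R) : Cc M f -> compact (closure [set x | f x != 0]).
Proof.
move=> [_ f0]; apply: (subclosed_compact _ (@rV_compact_ball R n M)).
  exact: closed_closure.
have cl : closed [set x : V | `|x| <= M].
  by apply: compact_closed; [exact: norm_hausdorff|exact: rV_compact_ball].
rewrite (closure_id [set x : V | `|x| <= M]).1//; apply: closure_subset => x /= fx.
by rewrite leNgt; apply: contra fx => /f0 ->.
Qed.

(** The kernel is exp(-1/(r^2 - |x|^2)) on the Euclidean ball of radius [r], which lies in the cube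
    that [Cc r] refers to. *)
Lemma mollifier (r : R) : 0 < r -> exists k : V -> R,
  [/\ Cc r k, partial_C1 k, forall y, 0 <= k y, 0 < k 0 &
      forall a, test_function (fun z => k (z - a))].
Proof.
move=> r0; pose k (x : V) := exp_bump 0 (r ^+ 2 - sqn (x - 0)).
have bk : bump_algebra 0 r k by exact: ba_bump.
have dk := bump_algebra_C1 bk.
have ck : Cc r k.
  split=> [|x rx]; first exact: dk.1.
  rewrite /k subr0 /exp_bump ifF//; apply/negbTE; rewrite -leNgt subr_le0.
  by rewrite (le_trans _ (normr_sqn x))// lerXn2r ?nnegrE// ltW.
exists k; split=> //.
- by move=> y; exact: exp_bump_ge0.
- rewrite /k subr0 /sqn big1; last by move=> i _; rewrite mxE expr0n.
  by rewrite subr0 /exp_bump exprn_gt0// mul1r expR_gt0.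
- move=> a; split; last exact: compact_support_Cc (Cc_shift (- a) ck).
  rewrite (_ : (fun z => _) = (fun z => exp_bump 0 (r ^+ 2 - sqn (z - a)))).
    by apply: bump_algebra_smooth; exact: ba_bump.
  by apply/funext => z; rewrite /k subr0.
Qed.

Lemma weak_divergence_test (F : 'I_n -> V -> R) G (psi : V -> R) (M : R) :
  (forall phi : V -> R, test_function phi ->
     - integral_Rn (fun x => \sum_i F i x * partial i phi x)
     = integral_Rn (fun x => G x * phi x)) ->
  (forall i, continuous (F i)) -> continuous G -> 0 <= M -> Cc M psi -> partial_C1 psi ->
  integral_Rn (fun x => \sum_i F i x * partial i psi x + G x * psi x) = 0.
Proof.
move=> H; apply: weak_divergence_C1 => r r0.
have [k [ck dk k0 k00 tk]] := mollifier r0.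
by exists k; split=> // a; exact: H.
Qed.

End TestFunctions.

(** * The p-Laplacian and Gaussian barriers *)

Section EuclideanNorm.
Context {R : realType} {n : nat}.
Local Notation V := 'rV[R]_n.
Implicit Types (a b q x y : V).

Lemma sqn_comb a b (s t : R) :
  sqn (s *: a + t *: b) = s ^+ 2 * sqn a + 2 * s * t * dot a b + t ^+ 2 * sqn b.
Proof.
rewrite /sqn /dot !mulr_sumr -!big_split /=; apply: eq_bigr => i _.
by rewrite !mxE; ring.
Qed.

Lemma sqnB a b : sqn (a - b) = sqn a - 2 * dot a b + sqn b.
Proof. by have := sqn_comb a b 1 (-1); rewrite scale1r scaleN1r => ->; ring. Qed.

Lemma sqnZ a (s : R) : sqn (s *: a) = s ^+ 2 * sqn a.
Proof. by have := sqn_comb a 0 s 0; rewrite scale0r addr0 => ->; ring. Qed.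

Lemma sqn_eq0 a : (sqn a == 0) = (a == 0).
Proof.
apply/eqP/eqP => [a0|->]; last by rewrite /sqn big1// => i _; rewrite mxE expr0n.
have := normr_sqn a; rewrite a0 => a2.
by apply/eqP; rewrite -normr_eq0 -sqrf_eq0 eq_le a2 sqr_ge0.
Qed.

Lemma sqn_gt0 a : (0 < sqn a) = (a != 0).
Proof. by rewrite lt_def sqn_eq0 sqn_ge0 andbT. Qed.

Lemma enormE a : enorm a = Num.sqrt (sqn a). Proof. by []. Qed.

Lemma enorm_ge0 a : 0 <= enorm a. Proof. exact: sqrtr_ge0. Qed.

Lemma sqr_enorm a : enorm a ^+ 2 = sqn a.
Proof. by rewrite sqr_sqrtr// sqn_ge0. Qed.

Lemma enorm_gt0 a : (0 < enorm a) = (a != 0).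
Proof. by rewrite sqrtr_gt0 sqn_gt0. Qed.

Lemma enorm0 : enorm (0 : V) = 0.
Proof. by rewrite /enorm big1 ?sqrtr0// => i _; rewrite mxE expr0n. Qed.

Lemma dot_le_enorm a b : dot a b <= enorm a * enorm b.
Proof.
have [->|a0] := eqVneq a 0.
  by rewrite enorm0 mul0r /dot big1// => i _; rewrite mxE mul0r.
have [->|b0] := eqVneq b 0.
  by rewrite enorm0 mulr0 /dot big1// => i _; rewrite mxE mulr0.
have := sqn_ge0 (enorm b *: a + (- enorm a) *: b).
rewrite sqn_comb -!sqr_enorm => H.
have AB : 0 < enorm a * enorm b by rewrite mulr_gt0 ?enorm_gt0.
rewrite -(ler_pM2l AB); lra.
Qed.

Lemma coord_le_enorm a i : `|a 0 i| <= enorm a.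
Proof.
rewrite -sqrtr_sqr ler_sqrt ?sqn_ge0// (bigD1 i)//= lerDl.
by apply: sumr_ge0 => j _; exact: sqr_ge0.
Qed.

Lemma continuous_sqn y : continuous (fun x => sqn (x - y)).
Proof. by move=> x; apply: differentiable_continuous; exact: differentiable_sqn. Qed.

Lemma continuous_enorm : continuous (@enorm R n).
Proof.
move=> x; apply: (@continuous_comp _ _ _ (@sqn R n) Num.sqrt); last exact: sqrt_continuous.
have := @continuous_sqn 0 x; congr (continuous_at _ _).
by apply/funext => z; rewrite subr0.
Qed.

(** [pflux p h x] is [pvec p (grad h x)] by conversion; isolating the map lets it be applied to
    barrier gradients too. *)
Definition pvec (p : R) q : V := enorm q `^ (p - 2) *: q.

Lemma enormM_powR p q : 1 < p -> enorm q * enorm q `^ (p - 2) = enorm q `^ (p - 1).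
Proof.
move=> p1; rewrite [in RHS](_ : p - 1 = (p - 2) + 1); last by ring.
have [->|q0] := eqVneq q 0.
  by rewrite enorm0 mul0r powR0//; apply: lt0r_neq0; lra.
have e0 : enorm q != 0 by rewrite gt_eqF ?enorm_gt0.
by rewrite [RHS]powRD ?e0 ?implybT// powRr1 ?enorm_ge0// mulrC.
Qed.

(** Cauchy-Schwarz on the cross term leaves (|a|^(p-1) - |b|^(p-1)) (|a| - |b|), nonnegative because
    t^(p-1) is increasing. *)
Lemma pvec_monotone p a b : 1 < p -> 0 <= dot (pvec p a - pvec p b) (a - b).
Proof.
move=> p1; set A := enorm a `^ (p - 2); set B := enorm b `^ (p - 2).
have -> : dot (pvec p a - pvec p b) (a - b)
    = A * sqn a + B * sqn b - (A + B) * dot a b.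
  rewrite /dot /sqn !mulr_sumr -!big_split /= -sumrN -big_split /=.
  by apply: eq_bigr => i _; rewrite !mxE -/A -/B; ring.
rewrite -!sqr_enorm.
have A0 : 0 <= A by exact: powR_ge0.
have B0 : 0 <= B by exact: powR_ge0.
have H : 0 <= (enorm a * A - enorm b * B) * (enorm a - enorm b).
  rewrite !enormM_powR//.
  have [ab|/ltW ba] := leP (enorm a) (enorm b).
    rewrite mulr_le0 ?subr_le0// ge0_ler_powR ?nnegrE ?enorm_ge0//; lra.
  rewrite mulr_ge0 ?subr_ge0// ge0_ler_powR ?nnegrE ?enorm_ge0//; lra.
have := ler_wpM2l (addr_ge0 A0 B0) (dot_le_enorm a b); lra.
Qed.

(** At 0 each component is at most |q|^(p-1), which tends to 0 even when |q|^(p-2) blows up. *)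
Lemma pvec_continuous p i : 1 < p -> continuous (fun q => pvec p q 0 i).
Proof.
move=> p1 q; have [->|q0] := eqVneq q 0.
  apply/continuousP_eps => e e0.
  have p10 : 0 < p - 1 by lra.
  pose t := e `^ (p - 1)^-1.
  have t0 : 0 < t by exact: powR_gt0.
  have [d d0 H] := (continuousP_eps (@enorm R n) 0).1 (@continuous_enorm 0) _ t0.
  exists d => // y /H; rewrite enorm0 sub0r normrN ger0_norm ?enorm_ge0// => yt.
  rewrite !mxE mulr0 sub0r normrN normrM ger0_norm ?powR_ge0//.
  apply: (@le_lt_trans _ _ (enorm y `^ (p - 1))).
    by rewrite -enormM_powR// mulrC ler_wpM2r ?powR_ge0// coord_le_enorm.
  have -> : e = t `^ (p - 1).
    by rewrite /t -powRrM mulVf ?gt_eqF// powRr1// ltW.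
  by rewrite gt0_ltr_powR ?nnegrE ?enorm_ge0// ltW.
rewrite (_ : (fun q => _) = (fun q => enorm q `^ (p - 2) * q 0 i)); last first.
  by apply/funext => z; rewrite mxE.
apply: continuous_at_mul; last exact: coord_continuous.
have H := @continuous_at_comp R V (fun t => t `^ (p - 2)) (@enorm R n) q.
apply: H; first exact: continuous_enorm.
by apply: is_derive_continuous; apply: is_derive1_powR; rewrite enorm_gt0.
Qed.

End EuclideanNorm.

Lemma near_neq (R : realType) n (x y : 'rV[R]_n) : x != y -> \forall z \near x, z != y.
Proof.
rewrite -subr_eq0 -sqn_gt0 => xy; have : \forall z \near x, 0 < sqn (z - y).
  exact: (@continuous_sqn R n y x [set r | 0 < r] (lt_nbhsr xy)).
by apply: filterS => z; rewrite sqn_gt0 subr_eq0.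
Qed.

Section Barrier.
Context {R : realType} {n : nat}.
Local Notation V := 'rV[R]_n.
Variables (p alpha c k : R) (y : V).
Hypothesis ac0 : 0 < alpha * c.
Implicit Type x : V.

Definition barrier x : R := c * expR (- alpha * sqn (x - y)) + k.

Definition barrier_grad x : V := (- 2 * (alpha * c) * expR (- alpha * sqn (x - y))) *: (x - y).

(* The vector [- barrier_weight (sqn (x - y)) *: (x - y)] is the p-flux of the barrier. *)
Definition barrier_weight (s : R) : R :=
  expR ((p - 1) * ln (2 * (alpha * c)) - alpha * (p - 1) * s + (p - 2) / 2 * ln s).

Lemma is_derive_barrier x v : is_derive x v barrier (dot v (barrier_grad x)).
Proof.
have H1 := is_derive_mull (- alpha) (is_derive_sqn x v y).
have H2 := @is_derive_compr R V expR (fun x => - alpha * sqn (x - y)) x v _ _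
  (is_derive_expR _) H1.
have := is_derive_add (is_derive_mull c H2) (is_derive_const x v k).
move/is_derive_eq; apply; rewrite addr0 /barrier_grad /dot !mulr_sumr.
by apply: eq_bigr => i _; rewrite !mxE; ring.
Qed.

Lemma continuous_barrier_exp x :
  continuous_at x (fun x => expR (- alpha * sqn (x - y))).
Proof.
apply: (@continuous_at_comp _ _ expR); last exact: continuous_expR.
by apply: continuous_at_mul; [exact: continuous_at_cst|exact: continuous_sqn].
Qed.

Lemma continuous_barrier : continuous barrier.
Proof.
move=> x; apply: continuous_at_add; last exact: continuous_at_cst.
by apply: continuous_at_mul; [exact: continuous_at_cst|exact: continuous_barrier_exp].
Qed.

Lemma continuous_barrier_grad i : continuous (fun x => barrier_grad x 0 i).
Proof.
rewrite (_ : (fun x => _) =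
  (fun x => (- 2 * (alpha * c) * expR (- alpha * sqn (x - y))) * (x 0 i - y 0 i))); last first.
  by apply/funext => x; rewrite !mxE.
move=> x; apply: continuous_at_mul.
  by apply: continuous_at_mul; [exact: continuous_at_cst|exact: continuous_barrier_exp].
by apply: continuous_at_sub; [exact: coord_continuous|exact: continuous_at_cst].
Qed.

Lemma continuous_barrier_gradV : continuous barrier_grad.
Proof.
move=> x.
have cs : continuous_at x (fun x : V => - 2 * (alpha * c) * expR (- alpha * sqn (x - y))).
  by apply: continuous_at_mul; [exact: continuous_at_cst|exact: continuous_barrier_exp].
by apply: (cvgZ cs); apply: cvgB; [exact: cvg_id|exact: cvg_cst].
Qed.

(** With s = |x-y|^2 and E = exp(-alpha s), the weight is (2 alpha c E)^(p-1) s^((p-2)/2); its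
    logarithm is the exponent in [barrier_weight]. Positivity of [alpha * c] and [x != y] give the
    logarithms positive arguments. *)
Lemma pvec_barrier x : x != y ->
  pvec p (barrier_grad x) = - barrier_weight (sqn (x - y)) *: (x - y).
Proof.
move=> xy; have s0 : 0 < sqn (x - y) by rewrite sqn_gt0 subr_eq0.
have a0 : 0 < 2 * (alpha * c) by rewrite mulr_gt0.
set E := expR (- alpha * sqn (x - y)).
have E0 : 0 < E by exact: expR_gt0.
have nE : enorm (barrier_grad x) = 2 * (alpha * c) * E * Num.sqrt (sqn (x - y)).
  rewrite enormE sqnZ sqrtrM ?sqr_ge0// sqrtr_sqr; congr (_ * _).
  by rewrite -/E !mulNr normrN gtr0_norm// mulr_gt0.
have sq0 : 0 < Num.sqrt (sqn (x - y)) by rewrite sqrtr_gt0.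
rewrite /pvec nE /barrier_grad scalerA; congr (_ *: _); rewrite -/E !mulNr mulrN; congr (- _).
have aE0 : 0 < 2 * (alpha * c) * E by rewrite mulr_gt0.
have tot0 : 0 < 2 * (alpha * c) * E * Num.sqrt (sqn (x - y)) by rewrite mulr_gt0.
rewrite /powR (gt_eqF tot0) -[X in _ * X = _]lnK ?posrE// -expRD.
rewrite /barrier_weight; congr expR.
rewrite (lnM aE0 sq0) (lnM a0 E0) /E expRK -powR12_sqrt ?ltW// ln_powR.
by field.
Qed.

Lemma is_derive_barrier_weight (s : R) : 0 < s ->
  is_derive s 1 barrier_weight (barrier_weight s * (- (alpha * (p - 1)) + (p - 2) / 2 / s)).
Proof.
move=> s0.
have H : is_derive s 1 (fun s : R => (p - 1) * ln (2 * (alpha * c)) - alpha * (p - 1) * s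
    + (p - 2) / 2 * ln s) (0 - alpha * (p - 1) * 1 + (p - 2) / 2 * s^-1).
  have H1 := is_derive_sub (is_derive_const s 1 ((p - 1) * ln (2 * (alpha * c))))
    (is_derive_mull (alpha * (p - 1)) (is_derive_id s 1)).
  exact: (is_derive_add H1 (is_derive_mull _ (is_derive1_ln s0))).
have := @is_derive_compr R R expR _ s 1 _ _ (is_derive_expR _) H.
by move/is_derive_eq; apply; rewrite sub0r mulr1.
Qed.

Definition barrier_flux_partial i x : R :=
  - (barrier_weight (sqn (x - y)) *
     (1 + 2 * (x - y) 0 i ^+ 2 * (- (alpha * (p - 1)) + (p - 2) / 2 / sqn (x - y)))).

Lemma is_derive_barrier_flux i x : x != y ->
  is_derive x (delta_mx 0 i) (fun z => - barrier_weight (sqn (z - y)) * (z - y) 0 i)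
    (barrier_flux_partial i x).
Proof.
move=> xy; have s0 : 0 < sqn (x - y) by rewrite sqn_gt0 subr_eq0.
have H1 := @is_derive_compr R V barrier_weight (fun z => sqn (z - y)) x (delta_mx 0 i) _ _
  (is_derive_barrier_weight s0) (is_derive_sqn x (delta_mx 0 i) y).
have H2 := is_derive_sub (is_derive_coord x (delta_mx 0 i) i)
  (is_derive_const x (delta_mx 0 i) (y 0 i)).
have := is_derive_mull (-1) (is_derive_mul H1 H2).
rewrite (_ : (fun z => -1 * _) =
    (fun z => - barrier_weight (sqn (z - y)) * (z - y) 0 i)); last first.
  by apply/funext => z; rewrite !mxE mulN1r mulNr.
move/is_derive_eq; apply; rewrite /barrier_flux_partial dot_delta !mxE !eqxx /=.
by ring.
Qed.

Lemma continuous_barrier_flux_partial i x : x != y ->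
  continuous_at x (barrier_flux_partial i).
Proof.
move=> xy; have s0 : 0 < sqn (x - y) by rewrite sqn_gt0 subr_eq0.
have cs : continuous_at x (fun z : V => sqn (z - y)) by exact: continuous_sqn.
have -> : barrier_flux_partial i = (fun z => -1 * (barrier_weight (sqn (z - y)) *
     (1 + 2 * (z - y) 0 i ^+ 2 * (- (alpha * (p - 1)) + (p - 2) / 2 / sqn (z - y))))).
  by apply/funext => z; rewrite mulN1r.
apply: continuous_at_mul; first exact: continuous_at_cst.
apply: continuous_at_mul.
  apply: (@continuous_at_comp _ _ barrier_weight) => //.
  exact: is_derive_continuous (is_derive_barrier_weight s0).
apply: continuous_at_add; first exact: continuous_at_cst.
apply: continuous_at_mul.
  apply: continuous_at_mul; first exact: continuous_at_cst.
  have -> : (fun z : V => (z - y) 0 i ^+ 2) =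
      (fun z => (z 0 i - y 0 i) * (z 0 i - y 0 i)).
    by apply/funext => z; rewrite !mxE expr2.
  by apply: continuous_at_mul; apply: continuous_at_sub;
    by [exact: coord_continuous|exact: continuous_at_cst].
apply: continuous_at_add; first exact: continuous_at_cst.
apply: continuous_at_mul; first exact: continuous_at_cst.
apply: (@continuous_at_comp R V GRing.inv) => //; apply: inv_continuous.
exact: lt0r_neq0.
Qed.

(** A radial field -w(s)(x-y) has divergence -(n w + 2 s w'), and here w'/w = -alpha (p-1) +
    (p-2)/(2s). Set against the drift -K w x.(x-y), this yields the inequality in
    [comparison_property]. *)
Lemma sum_barrier_flux_partial x : x != y ->
  \sum_i barrier_flux_partial i x = - (barrier_weight (sqn (x - y)) *
    (n%:R + p - 2 - 2 * alpha * (p - 1) * sqn (x - y))).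
Proof.
move=> xy; have s0 : 0 < sqn (x - y) by rewrite sqn_gt0 subr_eq0.
rewrite /barrier_flux_partial sumrN -mulr_sumr; congr (- (_ * _)).
rewrite big_split /= sumr_const card_ord -mulr_suml -mulr_sumr -/(sqn (x - y)).
by field; rewrite gt_eqF.
Qed.

End Barrier.

(** * Comparison with barriers *)

Section Gluing.
Context {R : realType} {V : normedModType R}.
Variables (U C : set V).
Hypotheses (oU : open U) (cC : closed C) (CU : C `<=` U).
Implicit Types (f : V -> R).

(** For [f] vanishing on [U] off [C], the cut-off agrees near every point of [C] with [f] and near
    every other point with 0. It therefore inherits regularity without any condition at the boundary
    of [U]. *)
Definition extend0 f x : R := if `[< U x >] then f x else 0.

Lemma extend0_in f x : U x -> extend0 f x = f x.
Proof. by move=> Ux; rewrite /extend0 asboolT. Qed.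

Lemma extend0_near_in f x : U x -> \forall z \near x, f z = extend0 f z.
Proof.
move=> Ux; near=> z; rewrite extend0_in//; near: z; exact: open_nbhs_nbhs.
Unshelve. all: by end_near. Qed.

Lemma extend0_near_out f x : (forall z, U z -> ~ C z -> f z = 0) -> ~ C x ->
  \forall z \near x, extend0 f z = 0.
Proof.
move=> f0 Cx; have : \forall z \near x, ~ C z.
  by apply: (@open_nbhs_nbhs _ x (~` C)); split=> //; exact: closed_openC.
by apply: filterS => z Cz; rewrite /extend0; case: ifP => // /asboolP Uz; exact: f0.
Qed.

Lemma extend0_out f x : (forall z, U z -> ~ C z -> f z = 0) -> ~ C x -> extend0 f x = 0.
Proof. by move=> f0 Cx; exact: nbhs_singleton (extend0_near_out f0 Cx). Qed.

Lemma continuous_near0 f x : (\forall z \near x, f z = 0) -> continuous_at x f.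
Proof.
move=> f0; rewrite /continuous_at (nbhs_singleton f0).
apply: (cvg_trans _ (@cvg_cst _ (0 : R) _ (nbhs x) _)).
by apply: near_eq_cvg; apply: filterS f0 => z.
Qed.

Lemma continuous_extend0 f : continuous f -> (forall z, U z -> ~ C z -> f z = 0) ->
  continuous (extend0 f).
Proof.
move=> cf f0 x; have [Cx|Cx] := pselect (C x); last first.
  by apply: continuous_near0; exact: extend0_near_out.
rewrite /continuous_at extend0_in; last exact: CU.
apply: (cvg_trans _ (cf x)); apply: near_eq_cvg.
by apply: extend0_near_in; exact: CU.
Qed.

Lemma is_derive_extend0 f (df : V -> R) x v : (forall z, is_derive z v f (df z)) ->
  (forall z, U z -> ~ C z -> f z = 0) -> (forall z, U z -> ~ C z -> df z = 0) ->
  is_derive x v (extend0 f) (extend0 df x).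
Proof.
move=> fd f0 df0; have [Cx|Cx] := pselect (C x); last first.
  rewrite extend0_out//; apply: DeriveDef.
    by apply: derivable_eq0_near; exact: extend0_near_out.
  by apply: derive_eq0_near; exact: extend0_near_out.
rewrite extend0_in; last exact: CU.
by apply: near_eq_is_derive (fd x); apply: extend0_near_in; exact: CU.
Qed.

End Gluing.

Section PositivePart.
Context {R : realType}.
Definition pos (t : R) := Num.max t 0.

Lemma pos_ge0 t : 0 <= pos t. Proof. by rewrite /pos le_max lexx orbT. Qed.

Lemma pos_eq0 t : t <= 0 -> pos t = 0. Proof. exact: max_idPr. Qed.

Lemma pos_gt0 t : 0 < t -> pos t = t. Proof. by move=> t0; apply: max_idPl; exact: ltW. Qed.

(** The square is what makes the positive part C^1, as a test function has to be. *)
Lemma is_derive_pos_sqr (t : R) : is_derive t 1 (fun s : R => pos s ^+ 2) (2 * pos t).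
Proof.
have [t0|t0|->] := ltgtP t 0.
- rewrite pos_eq0 ?ltW// mulr0.
  have E : \near t, cst 0 t = pos t ^+ 2.
    near=> s; rewrite /= pos_eq0 ?expr0n// ltW//; near: s; exact: lt_nbhsl.
  exact: (near_eq_is_derive E (is_derive_cst _ _ _)).
- rewrite pos_gt0//.
  have E : \near t, t * t = pos t ^+ 2.
    by near=> s; rewrite pos_gt0 ?expr2//; near: s; exact: lt_nbhsr.
  apply: (near_eq_is_derive E).
  apply: (is_derive_eq (is_derive_mul (is_derive_id t 1) (is_derive_id t 1))).
  by rewrite /=; ring.
suff H : (fun h : R => h^-1 *:
    (((fun s : R => pos s ^+ 2) \o shift 0) (h *: 1) - pos 0 ^+ 2)) @ 0^' --> (0 : R).
  apply: DeriveDef; first exact: cvgP H.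
  by rewrite /derive (cvg_lim _ H)// pos_eq0// mulr0.
apply/cvgrPdist_lt => e e0; exists e => //= h /=; rewrite sub0r normrN => he h0.
rewrite sub0r normrN addr0 [h%:A]mulr1 (pos_eq0 (lexx 0)) expr0n /= subr0 /GRing.scale /=.
have [hp|hn] := ltP 0 h; last by rewrite pos_eq0// expr0n mulr0 normr0.
by rewrite pos_gt0// expr2 mulrA mulVf// mul1r.
Unshelve. all: by end_near. Qed.

Lemma continuous_pos : continuous pos.
Proof.
rewrite (_ : pos = fun t => (t + `|t|) * 2^-1); last first.
  by apply/funext => t; rewrite /pos maxr_absE addr0 subr0.
move=> t; apply: continuous_at_mul; last exact: continuous_at_cst.
by apply: continuous_at_add; [exact: cvg_id|exact: norm_continuous].
Qed.

End PositivePart.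

(** The compact [C] inside [U] holds every point of [U] where the barrier reaches [h]; this replaces
    an ordering on the boundary of [U] and allows [U] to be the whole space. Only on [C] must the
    barrier be a strict subsolution. *)
Definition comparison_property (R : realType) (n : nat) (p K : R) (h : 'rV[R]_n -> R) :=
  forall (alpha c k : R) (y : 'rV[R]_n) (U C : set 'rV[R]_n),
  0 < alpha * c -> open U -> compact C -> C `<=` U ->
  (forall x, U x -> h x <= barrier alpha c k y x -> C x) ->
  (forall x, C x -> x != y /\
     n%:R + p - 2 < K * dot x (x - y) + 2 * alpha * (p - 1) * sqn (x - y)) ->
  forall x, U x -> barrier alpha c k y x <= h x.

(** * Comparison for weak solutions *)

Section WeakComparison.
Context {R : realType} {n : nat}.
Local Notation V := 'rV[R]_n.
Variables (p K : R) (h : V -> R).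
Hypotheses (p1 : 1 < p) (hsol : weak_solution p K h).

(** The equation thereby involves the flux alone, the form in which the Gaussian weight cancels the
    drift. *)
Lemma drift_pflux x : drift p K h x = K * dot x (pflux p h x).
Proof.
rewrite /drift -mulrA; congr (_ * _); rewrite /dot mulr_suml.
by apply: eq_bigr => i _; rewrite !mxE; ring.
Qed.

Lemma weak_continuous_pflux i : continuous (fun x => pflux p h x 0 i).
Proof.
move=> x; apply: (@continuous_comp _ _ _ (grad h) (fun q => pvec p q 0 i)).
  exact: hsol.1.2.
exact: pvec_continuous.
Qed.

(* Multiplying the test function by this weight absorbs the drift term. *)
Definition gauss (x : V) : R := expR (- (K / 2) * sqn (x - 0)).

Lemma is_derive_gauss i (x : V) : is_derive x (delta_mx 0 i) gauss (- K * x 0 i * gauss x).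
Proof.
have H := is_derive_mull (- (K / 2)) (is_derive_sqn x (delta_mx 0 i) 0).
apply: (is_derive_eq (@is_derive_compr R V expR (fun x => - (K / 2) * sqn (x - 0)) x _ _ _
  (is_derive_expR _) H)).
rewrite dot_delta /gauss subr0; by field.
Qed.

Lemma continuous_gauss : continuous gauss.
Proof.
move=> x; apply: (@continuous_at_comp _ _ expR); last exact: continuous_expR.
by apply: continuous_at_mul; [exact: continuous_at_cst|exact: continuous_sqn].
Qed.

Lemma weak_comparison : comparison_property p K h.
Proof.
move=> alpha c k y U C ac0 oU cptC CU UC Ccond x1 Ux1.
have cC : closed C by apply: compact_closed => //; exact: norm_hausdorff.
have [hC1 hC2] := hsol.1.
have ch : continuous h by move=> x; apply: differentiable_continuous; exact: hC1.
have cdh i : continuous (partial i h).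
  rewrite (_ : partial i h = fun x => grad h x 0 i); last by apply/funext => x; rewrite mxE.
  move=> x; apply: (@continuous_comp _ _ _ (grad h) (fun q : V => q 0 i : R)).
    exact: hC2.
  exact: coord_continuous.
rewrite leNgt; apply/negP => hv1.
pose v := barrier alpha c k y; pose gv := barrier_grad alpha c y.
pose u (x : V) : R := v x - h x.
pose gu (i : 'I_n) (x : V) : R := gv x 0 i - partial i h x.
have cv : continuous v by exact: continuous_barrier.
have cgv i : continuous (fun x => gv x 0 i) by exact: continuous_barrier_grad.
have du i x : is_derive x (delta_mx 0 i) u (gu i x).
  apply: is_derive_sub; last exact: is_derive_partial.
  by have := is_derive_barrier alpha c k y x (delta_mx 0 i); rewrite dot_delta.
have cu : continuous u by move=> x; apply: continuous_at_sub; [exact: cv|exact: ch].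
have cgu i : continuous (gu i) by move=> x; apply: continuous_at_sub; [exact: cgv|exact: cdh].
pose psi0 (x : V) : R := gauss x * pos (u x) ^+ 2.
pose dpsi0 (i : 'I_n) (x : V) : R :=
  - K * x 0 i * gauss x * pos (u x) ^+ 2 + gauss x * (2 * pos (u x) * gu i x).
have u_out z : U z -> ~ C z -> pos (u z) = 0.
  move=> Uz Cz; apply: pos_eq0; rewrite subr_le0 ltW// ltNge.
  by apply/negP => /(UC _ Uz).
have psi0_out z : U z -> ~ C z -> psi0 z = 0.
  by move=> Uz Cz; rewrite /psi0 u_out// expr0n mulr0.
have dpsi0_out i z : U z -> ~ C z -> dpsi0 i z = 0.
  by move=> Uz Cz; rewrite /dpsi0 u_out// expr0n !mulr0 mul0r mulr0 addr0.
have cpu : continuous (fun x => pos (u x)).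
  by move=> x; apply: (@continuous_at_comp _ _ pos); [exact: cu|exact: continuous_pos].
have cpu2 : continuous (fun x => pos (u x) ^+ 2).
  by move=> x; apply: continuous_at_mul; exact: cpu.
have cpsi0 : continuous psi0.
  by move=> x; apply: continuous_at_mul; [exact: continuous_gauss|exact: cpu2].
have cdpsi0 i : continuous (dpsi0 i).
  move=> x; apply: continuous_at_add.
    apply: continuous_at_mul; last exact: cpu2.
    apply: continuous_at_mul; last exact: continuous_gauss.
    by apply: continuous_at_mul; [exact: continuous_at_cst|exact: coord_continuous].
  apply: continuous_at_mul; first exact: continuous_gauss.
  apply: continuous_at_mul; last exact: cgu.
  by apply: continuous_at_mul; [exact: continuous_at_cst|exact: cpu].
have dpsi0P i x : is_derive x (delta_mx 0 i) psi0 (dpsi0 i x).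
  apply: is_derive_mul; first exact: is_derive_gauss.
  exact: (is_derive_compr (is_derive_pos_sqr (u x)) (du i x)).
(* Nothing is known about the sign of [u] outside [U], hence the cut-off. *)
pose psi := extend0 U psi0.
have psiP i x : is_derive x (delta_mx 0 i) psi (extend0 U (dpsi0 i) x).
  exact: (is_derive_extend0 oU cC CU _ (dpsi0P i) psi0_out (dpsi0_out i)).
have dpsiE i : partial i psi = extend0 U (dpsi0 i).
  by apply/funext => x; exact: partialE.
have psiC1 : partial_C1 psi.
  split; first exact: (continuous_extend0 oU cC CU cpsi0 psi0_out).
  move=> i; split; first by move=> x; case: (psiP i x).
  by rewrite dpsiE; exact: (continuous_extend0 oU cC CU (cdpsi0 i) (dpsi0_out i)).
have [M M0 CM] : exists2 M : R, 0 <= M & forall x, C x -> `|x| <= M.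
  have [M [_ HM]] := compact_bounded cptC.
  exists (Num.max (M + 1) 0); first by rewrite le_max lexx orbT.
  move=> x Cx; rewrite le_max; apply/orP; left; apply: (HM (M + 1)) => //.
  by rewrite ltrDl.
have Mout x : M < `|x| -> ~ C x by move=> Mx /CM; rewrite leNgt Mx.
have cpsi : Cc M psi.
  split; first exact: psiC1.1.
  by move=> x /Mout Cx; exact: (extend0_out cC psi0_out Cx).
have cdpsi i : Cc M (partial i psi) by apply: Cc_partial => //; exact: (psiC1.2 i).2.
(* The barrier flux is differentiated by its formula away from [y] only; near [y] the test function
   vanishes, so products with it remain C^1. *)
have yC : ~ C y by move=> /Ccond[]; rewrite eqxx.
have cpf := weak_continuous_pflux.
have cdrift : continuous (drift p K h).
  rewrite (_ : drift p K h = fun x => K * \sum_i x 0 i * pflux p h x 0 i); last first.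
    by apply/funext => x; rewrite drift_pflux.
  move=> x; apply: continuous_at_mul; first exact: continuous_at_cst.
  apply: continuous_sum => i z; apply: continuous_at_mul; first exact: coord_continuous.
  exact: cpf.
have E1 := weak_divergence_test hsol.2 cpf cdrift M0 cpsi psiC1.
pose pv (x : V) : V := pvec p (gv x).
pose D i := barrier_flux_partial p alpha c y i.
have cpv i : continuous (fun x => pv x 0 i).
  move=> x; apply: (@continuous_comp _ _ _ gv (fun q => pvec p q 0 i)).
    exact: continuous_barrier_gradV.
  exact: pvec_continuous.
have psi_y : \forall z \near y, psi z = 0 by exact: (extend0_near_out cC psi0_out yC).
have dpsi_y i : \forall z \near y, partial i psi z = 0.
  by rewrite dpsiE; exact: (extend0_near_out cC (dpsi0_out i) yC).
(* The barrier flux times [psi] has compact support, so its divergence integrates to 0; this is the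
   barrier's counterpart of [E1]. *)
pose g i (x : V) : R := pv x 0 i * psi x.
pose dg i (x : V) : R := D i x * psi x + pv x 0 i * partial i psi x.
have gP i x : is_derive x (delta_mx 0 i) (g i) (dg i x).
  have [->|xy] := eqVneq x y.
    have gy : \forall z \near y, g i z = 0.
      by apply: filterS psi_y => z pz; rewrite /g pz mulr0.
    rewrite /dg (nbhs_singleton psi_y) (nbhs_singleton (dpsi_y i)) !mulr0 addr0.
    by apply: DeriveDef; [exact: derivable_eq0_near|exact: derive_eq0_near].
  have H : is_derive x (delta_mx 0 i) (fun z => pv z 0 i) (D i x).
    have E : \near x, - barrier_weight p alpha c (sqn (x - y)) * (x - y) 0 i = pv x 0 i.
      apply: filterS (near_neq xy) => z zy.
      by rewrite /pv /gv pvec_barrier// [RHS]mxE.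
    exact: (near_eq_is_derive E (is_derive_barrier_flux p alpha c i xy)).
  by have := is_derive_mul H (psiP i x); rewrite -dpsiE.
have cdg i : continuous (dg i).
  move=> x; apply: continuous_at_add.
    have [->|xy] := eqVneq x y.
      apply: continuous_near0; apply: filterS psi_y => z pz; by rewrite pz mulr0.
    apply: continuous_at_mul; last exact: psiC1.1.
    exact: continuous_barrier_flux_partial.
  by apply: continuous_at_mul; [exact: cpv|exact: (psiC1.2 i).2].
have dgE i : dg i = partial i (g i) by apply/funext => x; apply/esym/partialE.
have ccg i : Cc M (g i) by exact: CcM.
have ccdg i : Cc M (dg i) by rewrite dgE; apply: Cc_partial => //; rewrite -dgE; exact: cdg.
have E2 : integral_Rn (fun x => \sum_i dg i x) = 0.
  rewrite (integral_Rn_sum M0)// big1// => i _; rewrite dgE.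
  apply: (integral_Rn_partial M0 (ccg i)); last by rewrite -dgE; exact: cdg.
  by move=> x; have [] := gP i x.
have cc1 : Cc M (fun x => \sum_i pflux p h x 0 i * partial i psi x + drift p K h x * psi x).
  by apply: CcD; [apply: Cc_sum => i; exact: CcM|exact: CcM].
have cc2 : Cc M (fun x => \sum_i dg i x) by exact: Cc_sum.
have := integral_RnB M0 cc2 cc1; rewrite E1 E2 subrr.
pose wt x := barrier_weight p alpha c (sqn (x - y)).
(* The gradient of the weight contributes -K x.(pv - F) psi, with F the flux of [h]; its F part
   cancels the drift of [h]. What is left is [psi] times the strict subsolution excess, plus the
   monotonicity term for the two fluxes. *)
have IE x : C x ->
    \sum_i dg i x - (\sum_i pflux p h x 0 i * partial i psi x + drift p K h x * psi x)
   = gauss x * pos (u x) ^+ 2 * (wt x * (K * dot x (x - y) + 2 * alpha * (p - 1) * sqn (x - y)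
        - (n%:R + p - 2)))
     + 2 * gauss x * pos (u x) * dot (pv x - pflux p h x) (gv x - grad h x).
  move=> Cx; have [xy _] := Ccond _ Cx.
  have -> : wt x * (K * dot x (x - y) + 2 * alpha * (p - 1) * sqn (x - y) - (n%:R + p - 2)) =
      \sum_i D i x - K * dot x (pv x).
    rewrite /D sum_barrier_flux_partial// /pv /gv pvec_barrier// /dot -/(wt x).
    rewrite [in RHS](_ : \sum_i _ = - wt x * \sum_i x 0 i * (x - y) 0 i); first by ring.
    by rewrite mulr_sumr; apply: eq_bigr => i _; rewrite !mxE; ring.
  have psiE : psi x = gauss x * pos (u x) ^+ 2 by rewrite /psi extend0_in//; exact: CU.
  have dpE i : partial i psi x = dpsi0 i x by rewrite dpsiE extend0_in//; exact: CU.
  have subE (A B : V) i : (A - B) 0 i = A 0 i - B 0 i by rewrite !mxE.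
  have gradE i : grad h x 0 i = partial i h x by rewrite mxE.
  rewrite drift_pflux psiE mulrBr /dot !mulr_sumr opprD addrA -!sumrN mulr_suml -!big_split /=.
  rewrite -sumrN -!big_split /=.
  apply: eq_bigr => i _; rewrite /dg psiE dpE /dpsi0 /gu !subE gradE; ring.
(* The integrand is nonnegative everywhere and positive at [x1], so its integral cannot be 0. *)
apply/eqP; rewrite gt_eqF//.
have wt0 x : 0 < wt x by exact: expR_gt0.
have ga0 x : 0 < gauss x by exact: expR_gt0.
have mono x : 0 <= dot (pv x - pflux p h x) (gv x - grad h x) by exact: pvec_monotone.
apply: (@integral_Rn_gt0 _ _ M _ x1) => //; first exact: CcB.
  move=> x; have [Cx|Cx] := pselect (C x); last first.
    have px : psi x = 0 by exact: (extend0_out cC psi0_out Cx).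
    have dpx i : partial i psi x = 0 by rewrite dpsiE; exact: (extend0_out cC (dpsi0_out i) Cx).
    rewrite px mulr0 addr0 !big1 ?subrr// => i _; rewrite ?dpx ?mulr0//.
    by rewrite /dg px dpx !mulr0 addr0.
  have [xy cx] := Ccond _ Cx.
  rewrite IE// addr_ge0//; last by apply: mulr_ge0 => //; rewrite !mulr_ge0 ?pos_ge0// ltW.
  by apply: mulr_ge0; rewrite mulr_ge0 ?sqr_ge0 ?ltW// subr_gt0.
have Cx1 : C x1 by apply: UC => //; exact: ltW.
have [xy cx] := Ccond _ Cx1.
have u0 : 0 < u x1 by rewrite subr_gt0.
rewrite IE// pos_gt0// ltr_pwDl//; last by apply: mulr_ge0 => //; rewrite !mulr_ge0// ltW.
by rewrite mulr_gt0 ?mulr_gt0 ?exprn_gt0// subr_gt0.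
Qed.

End WeakComparison.

(** * Second-order conditions at a maximum *)

Section SecondOrder.
Context {R : realType}.

(** If [b] were positive, [psi] would be positive just to the right of 0 and the mean value theorem
    would give a value of [phi] above [phi 0]. The second derivative is requested at 0 only, since
    [h] is known to be twice differentiable only at the contact point. *)
Lemma second_derivative_at_max (phi psi : R -> R) (b : R) :
  (forall t : R, is_derive t 1 phi (psi t)) -> psi 0 = 0 -> is_derive (0 : R) 1 psi b ->
  (\forall t \near (0 : R), phi t <= phi 0) -> b <= 0.
Proof.
move=> dphi psi0 [dpsi dpsiE] /nbhs_normP[d /= d0 Hd]; rewrite leNgt; apply/negP => b0.
have : (fun h : R => h^-1 *: ((psi \o shift 0) (h *: 1) - psi 0)) @ 0^' --> b.
  by rewrite -dpsiE; exact: dpsi.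
move=> /cvgrPdist_lt /(_ _ b0) [e /= e0 He].
pose t := Num.min d e / 2.
have t0 : 0 < t by rewrite divr_gt0// lt_min d0.
have tde : t < Num.min d e by rewrite ltr_pdivrMr ?ltr_pMr ?ltr1n// lt_min d0.
move: tde; rewrite lt_min => /andP[td te].
have cphi : continuous phi.
  by move=> s; have := dphi s; exact: is_derive_continuous.
have [s + E] := MVT t0 (fun s _ => dphi s) (continuous_subspaceT cphi).
rewrite in_itv /= => /andP[s0 st].
have ps : 0 < psi s.
  have := He s; rewrite /= sub0r normrN (gtr0_norm s0) => /(_ (lt_trans st te) (lt0r_neq0 s0)).
  rewrite psi0 subr0 addr0 [s%:A]mulr1 => /ltr_normlW H.
  have : 0 < s^-1 * psi s by move: H; rewrite /GRing.scale /=; lra.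
  by rewrite pmulr_rgt0// invr_gt0.
have := Hd t; rewrite /= sub0r normrN gtr0_norm// => /(_ td).
rewrite -subr_le0 E subr0 leNgt => /negP; apply; exact: mulr_gt0.
Qed.

Lemma derivative_at_max (phi : R -> R) (b : R) :
  (forall t : R, derivable phi t 1) -> is_derive (0 : R) 1 phi b ->
  (\forall t \near (0 : R), phi t <= phi 0) -> b = 0.
Proof.
move=> dphi db /nbhs_normP[d /= d0 Hd].
have dd : - d <= d by lra.
have := @derive1_at_max R phi (- d) d 0 dd (fun t _ => dphi t).
rewrite in_itv /= oppr_lt0 d0 => /(_ isT) [|_ <-]; last by case: db.
move=> t; rewrite in_itv /= => /andP[t1 t2]; apply: Hd.
by rewrite /= sub0r normrN ltr_norml t1.
Qed.

End SecondOrder.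

Section ChainRules.
Context {R : realType} {n : nat}.
Local Notation V := 'rV[R]_n.
Implicit Types (x y v : V).

Lemma derive_partial (f : V -> R) x v : differentiable f x ->
  'D_v f x = \sum_j v 0 j * partial j f x.
Proof.
move=> df; rewrite deriveE// [in LHS](row_sum_delta v) linear_sum.
by apply: eq_bigr => j _; rewrite linearZ /partial deriveE.
Qed.

(** The conjugate exponent p' = p/(p-1) satisfies p' - 2 = (2-p)/(p-1), while the flux has norm
    |q|^(p-1); the two powers cancel. *)
Lemma pvec_inverse p (q : V) : 1 < p -> pvec (p / (p - 1)) (pvec p q) = q.
Proof.
move=> p1; have [->|q0] := eqVneq q 0; first by rewrite /pvec !scaler0.
have e0 : 0 < enorm q by rewrite enorm_gt0.
have eE : enorm (pvec p q) = enorm q `^ (p - 1).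
  rewrite enormE sqnZ sqrtrM ?sqr_ge0// sqrtr_sqr ger0_norm ?powR_ge0//.
  by rewrite -enormE mulrC enormM_powR.
rewrite {1}/pvec eE -powRrM /pvec scalerA.
rewrite -powRD ?(gt_eqF e0) ?implybT//.
rewrite (_ : _ + _ = 0) ?powRr0 ?scale1r//.
by field; rewrite subr_eq0 gt_eqF.
Qed.

(** The linearisation of q -> |q|^(p-2) q at q != 0 is |q|^(p-2) (I + (p-2) e e^T) with e =
    q/|q|. *)
Lemma is_derive_pvec p (F : V -> V) (dF : 'I_n -> R) x v i :
  (forall k, is_derive x v (fun z => F z 0 k) (dF k)) -> F x != 0 ->
  is_derive x v (fun z => pvec p (F z) 0 i)
    (enorm (F x) `^ (p - 2) *
      (dF i + (p - 2) / sqn (F x) * (\sum_k F x 0 k * dF k) * F x 0 i)).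
Proof.
move=> hF Fx; have s0 : 0 < sqn (F x) by rewrite sqn_gt0.
have e0 : 0 < enorm (F x) by rewrite enorm_gt0.
have Hs : is_derive x v (fun z => sqn (F z)) (2 * \sum_k F x 0 k * dF k).
  have H := is_derive_sumf (fun k => is_derive_mul (hF k) (hF k)).
  rewrite (_ : (fun z => sqn (F z)) = fun z => \sum_i F z 0 i * F z 0 i); last first.
    by apply/funext => z; apply: eq_bigr => j _; rewrite expr2.
  by apply: (is_derive_eq H); rewrite mulr_sumr; apply: eq_bigr => j _; ring.
have He := @is_derive_compr R V Num.sqrt _ x v _ _ (is_derive1_sqrt s0) Hs.
have Hp := @is_derive_compr R V (fun t => t `^ (p - 2)) (fun z => enorm (F z)) x v _ _
  (is_derive1_powR (p - 2) e0) He.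
rewrite (_ : (fun z => _) = fun z => enorm (F z) `^ (p - 2) * F z 0 i); last first.
  by apply/funext => z; rewrite mxE.
apply: (is_derive_eq (is_derive_mul Hp (hF i))); rewrite -enormE.
have -> : enorm (F x) `^ (p - 2 - 1) = enorm (F x) `^ (p - 2) / enorm (F x).
  by rewrite powRB ?(gt_eqF e0) ?implybT// powRr1// ltW.
by rewrite -(sqr_enorm (F x)); field; rewrite gt_eqF.
Qed.

Lemma differentiable_pvec p (F : V -> V) x i :
  (forall k, differentiable (fun z => F z 0 k) x) -> F x != 0 ->
  differentiable (fun z => pvec p (F z) 0 i) x.
Proof.
move=> hF Fx; have s0 : 0 < sqn (F x) by rewrite sqn_gt0.
have e0 : 0 < enorm (F x) by rewrite enorm_gt0.
have Hs : differentiable (fun z => sqn (F z)) x.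
  have := @differentiable_sum _ _ _ n (fun i z => F z 0 i * F z 0 i) x.
  rewrite (_ : \sum_(i < n) _ = (fun z => sqn (F z))); last first.
    by apply/funext => z; rewrite fct_sumE; apply: eq_bigr => j _; rewrite expr2.
  by apply=> j; apply: differentiableM.
have He : differentiable (fun z => enorm (F z)) x.
  apply: (@differentiable_comp _ _ _ _ (fun z => sqn (F z)) Num.sqrt) => //.
  by apply/derivable1_diffP; apply: ex_derive; exact: is_derive1_sqrt.
have Hp : differentiable (fun z => enorm (F z) `^ (p - 2)) x.
  apply: (@differentiable_comp _ _ _ _ (fun z => enorm (F z)) (fun t => t `^ (p - 2))) => //.
  by apply/derivable1_diffP; apply: ex_derive; exact: is_derive1_powR.
rewrite (_ : (fun z => _) = fun z => enorm (F z) `^ (p - 2) * F z 0 i); last first.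
  by apply/funext => z; rewrite mxE.
exact: differentiableM.
Qed.

Lemma differentiable_barrier_exp (alpha : R) y x :
  differentiable (fun z => expR (- alpha * sqn (z - y))) x.
Proof.
apply: (@differentiable_comp _ _ _ _ (fun z => - alpha * sqn (z - y)) expR).
  by apply: differentiableM; [exact: differentiable_cst|exact: differentiable_sqn].
by apply/derivable1_diffP; exact: derivable_expR.
Qed.

Lemma differentiable_barrier (alpha c k : R) y x : differentiable (barrier alpha c k y) x.
Proof.
apply: differentiableD; last exact: differentiable_cst.
by apply: differentiableM; [exact: differentiable_cst|exact: differentiable_barrier_exp].
Qed.

Lemma differentiable_barrier_grad (alpha c : R) y x i :
  differentiable (fun z => barrier_grad alpha c y z 0 i) x.
Proof.
rewrite (_ : (fun z => _) =
  (fun z => (- 2 * (alpha * c) * expR (- alpha * sqn (z - y))) * (z 0 i - y 0 i))); last first.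
  by apply/funext => z; rewrite !mxE.
apply: differentiableM.
  by apply: differentiableM; [exact: differentiable_cst|exact: differentiable_barrier_exp].
by apply: differentiableB; [exact: differentiable_coord|exact: differentiable_cst].
Qed.

Definition quadratic (M : 'I_n -> 'I_n -> R) v := \sum_i \sum_j v 0 i * v 0 j * M i j.

(* With [e = q / |q|], the left-hand side is
   [\sum_i quadratic M (e_i - (e_i . e) e) + (p - 1) quadratic M e]. *)
Lemma plaplace_trace_le0 (M : 'I_n -> 'I_n -> R) (q : V) p : 1 < p -> q != 0 ->
  (forall v, quadratic M v <= 0) ->
  \sum_i M i i + (p - 2) / sqn q * quadratic M q <= 0.
Proof.
move=> p1 q0 HM; have s0 : 0 < sqn q by rewrite sqn_gt0.
set s := sqn q in s0 *.
(* [L] and [L'] differ for a non-symmetric [M], but each paired with [q] gives [quadratic M q]. *)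
pose L i := \sum_j q 0 j * M i j.
pose L' i := \sum_j q 0 j * M j i.
have QL : quadratic M q = \sum_i q 0 i * L i.
  by apply: eq_bigr => i _; rewrite mulr_sumr; apply: eq_bigr => j _; rewrite mulrA.
have QL' : quadratic M q = \sum_i q 0 i * L' i.
  rewrite /quadratic exchange_big /=; apply: eq_bigr => i _; rewrite mulr_sumr.
  by apply: eq_bigr => j _; ring.
have Qi i : quadratic M (delta_mx 0 i - (q 0 i / s) *: q) =
    M i i - q 0 i / s * (L i + L' i) + (q 0 i / s) ^+ 2 * quadratic M q.
  have dl k : (delta_mx 0 i : V) 0 k = (k == i)%:R by rewrite mxE eqxx.
  rewrite /quadratic.
  have -> : M i i = \sum_k \sum_j (k == i)%:R * (j == i)%:R * M k j.
    rewrite (bigD1 i)//= [X in _ = _ + X]big1 ?addr0 => [|k /negbTE ->]; last first.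
      by rewrite big1// => j _; rewrite !mul0r.
    rewrite (bigD1 i)//= big1 ?addr0 => [|j /negbTE ->]; last by rewrite mulr0 mul0r.
    by rewrite eqxx !mul1r.
  have -> : L i = \sum_k \sum_j (k == i)%:R * q 0 j * M k j.
    rewrite (bigD1 i)//= [X in _ = _ + X]big1 ?addr0 => [|k /negbTE ->]; last first.
      by rewrite big1// => j _; rewrite !mul0r.
    by apply: eq_bigr => j _; rewrite eqxx mul1r.
  have -> : L' i = \sum_k \sum_j q 0 k * (j == i)%:R * M k j.
    apply: eq_bigr => k _; rewrite (bigD1 i)//= big1 ?addr0 => [|j /negbTE ->].
      by rewrite eqxx mulr1.
    by rewrite mulr0 mul0r.
  rewrite -big_split /= !mulr_sumr -sumrN -!big_split /=; apply: eq_bigr => k _.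
  rewrite -big_split /= !mulr_sumr -sumrN -!big_split /=; apply: eq_bigr => j _.
  by rewrite !mxE !eqxx /=; ring.
have H : \sum_i quadratic M (delta_mx 0 i - (q 0 i / s) *: q) =
    \sum_i M i i - quadratic M q / s.
  under eq_bigr do rewrite Qi.
  rewrite big_split /= sumrB.
  have -> : \sum_i q 0 i / s * (L i + L' i) = 2 * quadratic M q / s.
    rewrite -[RHS](_ : (quadratic M q + quadratic M q) / s = _); last by ring.
    rewrite {1}QL QL' -big_split /= mulr_suml; apply: eq_bigr => i _; ring.
  have -> : \sum_i (q 0 i / s) ^+ 2 * quadratic M q = quadratic M q / s.
    rewrite -mulr_suml (eq_bigr (fun i => q 0 i ^+ 2 * s ^- 2)); last first.
      by move=> i _; rewrite expr_div_n.
    rewrite -mulr_suml -/(sqn q) -/s; field; exact: lt0r_neq0.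
  ring.
(* The projections use up one copy of the direction [q], turning [p - 2], possibly negative, into
   [p - 1 > 0]. *)
have -> : \sum_i M i i + (p - 2) / s * quadratic M q =
   \sum_i quadratic M (delta_mx 0 i - (q 0 i / s) *: q) + (p - 1) / s * quadratic M q.
  by rewrite H; field; exact: lt0r_neq0.
rewrite -[leRHS]addr0 lerD//; first by apply: sumr_le0 => i _.
rewrite mulr_ge0_le0// divr_ge0 ?ltW// subr_gt0//.
Qed.

End ChainRules.

(** * Comparison for classical solutions *)

Section ClassicalComparison.
Context {R : realType} {n : nat}.
Local Notation V := 'rV[R]_n.
Variables (p K : R) (h : V -> R).
Hypotheses (p1 : 1 < p) (hsol : classical_solution p K h).

(** For F = Du this is the nondivergence form |Du|^(p-2) (Laplacian u + (p-2) u_i u_j u_ij /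
    |Du|^2). *)
Lemma sum_is_derive_pvec (F : V -> V) (dF : 'I_n -> 'I_n -> R) (x : V) :
  (forall i k, is_derive x (delta_mx 0 i) (fun z => F z 0 k) (dF i k)) -> F x != 0 ->
  \sum_i partial i (fun z => pvec p (F z) 0 i) x = enorm (F x) `^ (p - 2) *
    (\sum_i dF i i + (p - 2) / sqn (F x) * quadratic dF (F x)).
Proof.
move=> hF Fx; rewrite /quadratic !mulr_sumr -big_split mulr_sumr /=.
apply: eq_bigr => i _; rewrite (partialE (is_derive_pvec p i (hF i) Fx)).
congr (_ * (_ + _)); rewrite mulrAC -mulrA; congr (_ * _); rewrite mulr_sumr.
by apply: eq_bigr => j _; ring.
Qed.

(** At the maximum the two gradients agree and do not vanish, and the Hessian of the difference is
    nonpositive; hence the barrier's p-Laplacian is at most that of [h], which is the drift.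
    Dividing by the positive weight negates the strict subsolution inequality. *)
Lemma local_max_contra (alpha c k : R) (y x : V) : 0 < alpha * c -> x != y ->
  (\forall z \near x, barrier alpha c k y z - h z <= barrier alpha c k y x - h x) ->
  K * dot x (x - y) + 2 * alpha * (p - 1) * sqn (x - y) <= n%:R + p - 2.
Proof.
move=> ac0 xy umax; have [dh dP divP] := hsol.
pose gv := barrier_grad alpha c y.
pose u z := barrier alpha c k y z - h z.
have du z : differentiable u z.
  by apply: differentiableB; [exact: differentiable_barrier|exact: dh].
pose G i z := gv z 0 i - partial i h z.
have pu i z : partial i u z = G i z.
  apply: partialE; apply: is_derive_sub; last exact: is_derive_partial.
  by have := is_derive_barrier alpha c k y z (delta_mx 0 i); rewrite dot_delta.
have line_max (v : V) : \forall t \near (0 : R), u (x + t *: v) <= u (x + 0 *: v).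
  have cl : (fun t : R => x + t *: v) @ (0 : R) --> x.
    rewrite -{2}[x]addr0 -[X in _ --> x + X](scale0r v).
    by apply: cvgD; [exact: cvg_cst|apply: cvgZl; exact: cvg_id].
  rewrite scale0r addr0; exact: (cl _ umax).
have dline (v : V) (t : R) : is_derive t 1 (fun s : R => u (x + s *: v))
    (\sum_j v 0 j * G j (x + t *: v)).
  have D : derivable u (x + t *: v) v by apply: diff_derivable; exact: du.
  have H := is_derive_line D.
  apply: (is_derive_eq H); rewrite derive_partial//.
  by apply: eq_bigr => j _; rewrite pu.
have G0 i : G i x = 0.
  have dd t : derivable (fun s : R => u (x + s *: delta_mx 0 i)) t 1.
    by case: (dline (delta_mx 0 i) t).
  have := derivative_at_max dd (dline (delta_mx 0 i) 0) (line_max (delta_mx 0 i)).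
  rewrite scale0r addr0 => E0; have := dot_delta (\row_j G j x) i.
  rewrite /dot [in RHS]mxE => <-; rewrite -[RHS]E0.
  by apply: eq_bigr => j _; congr (_ * _); rewrite mxE.
have gvE : grad h x = gv x.
  by apply/rowP => i; rewrite [LHS]mxE; apply/esym/eqP; rewrite -subr_eq0; apply/eqP/G0.
have q0 : gv x != 0.
  rewrite /gv /barrier_grad scaler_eq0 subr_eq0 (negbTE xy) orbF !mulNr oppr_eq0.
  by rewrite gt_eqF// mulr_gt0 ?expR_gt0// mulr_gt0.
have P0 : pflux p h x != 0.
  by rewrite /pflux gvE scaler_eq0 negb_or q0 andbT gt_eqF// powR_gt0// enorm_gt0.
(* [grad h] is recovered from the flux by the conjugate power map, so [h] is
   twice differentiable at [x] although this is not assumed. *)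
have dh2 i : differentiable (partial i h) x.
  rewrite (_ : partial i h = fun z => pvec (p / (p - 1)) (pflux p h z) 0 i); last first.
    by apply/funext => z; rewrite -[pflux p h z]/(pvec p (grad h z)) pvec_inverse// mxE.
  apply: differentiable_pvec => // j.
  apply: (@differentiable_comp _ _ _ _ (pflux p h) (fun q : V => q 0 j : R)) => //.
  exact: differentiable_coord.
have dgv i := @differentiable_barrier_grad R n alpha c y x i.
have dG i : differentiable (G i) x by apply: differentiableB.
pose M i j := partial i (G j) x.
(* The derivative of [u] along the line is known everywhere, and it is differentiated once more at
   [x] alone. *)
have Mle v : quadratic M v <= 0.
  apply: (second_derivative_at_max (dline v) _ _ (line_max v)).
    by rewrite big1// => j _; rewrite scale0r addr0 G0 mulr0.
  have H j : is_derive (0 : R) 1 (fun t : R => v 0 j * G j (x + t *: v)) (v 0 j * 'D_v (G j) x).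
    apply: is_derive_mull.
    have := @is_derive_line R V (G j) x v 0; rewrite scale0r addr0; apply.
    exact: diff_derivable.
  apply: (is_derive_eq (is_derive_sumf H)).
  rewrite /quadratic exchange_big /=; apply: eq_bigr => j _.
  by rewrite derive_partial// mulr_sumr; apply: eq_bigr => i _; rewrite /M; ring.
have tr := plaplace_trace_le0 p1 q0 Mle.
pose B i j := partial i (partial j h) x.
pose W i j := partial i (fun z => gv z 0 j) x.
have hB i j : is_derive x (delta_mx 0 i) (fun z => grad h z 0 j) (B i j).
  rewrite (_ : (fun z => grad h z 0 j) = partial j h); last by apply/funext => z; rewrite mxE.
  exact: is_derive_partial.
have hW i j : is_derive x (delta_mx 0 i) (fun z => gv z 0 j) (W i j) by exact: is_derive_partial.
have ME i j : M i j = W i j - B i j.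
  exact: (partialE (is_derive_sub (hW i j) (is_derive_partial i (dh2 j)))).
(* As the gradients coincide at [x], both nondivergence forms have the same coefficients and their
   difference is governed by [M]. *)
have divh : divergence (pflux p h) x = enorm (gv x) `^ (p - 2) *
    (\sum_i B i i + (p - 2) / sqn (gv x) * quadratic B (gv x)).
  by rewrite -gvE -(sum_is_derive_pvec hB) ?gvE.
have divv : - (barrier_weight p alpha c (sqn (x - y)) *
    (n%:R + p - 2 - 2 * alpha * (p - 1) * sqn (x - y))) = enorm (gv x) `^ (p - 2) *
    (\sum_i W i i + (p - 2) / sqn (gv x) * quadratic W (gv x)).
  rewrite -(sum_is_derive_pvec hW)// -sum_barrier_flux_partial//.
  apply: eq_bigr => i _; apply/esym/partialE.
  have E : \near x, - barrier_weight p alpha c (sqn (x - y)) * (x - y) 0 i = pvec p (gv x) 0 i.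
    apply: filterS (near_neq xy) => z zy.
    by rewrite /gv pvec_barrier// [RHS]mxE.
  exact: (near_eq_is_derive E (is_derive_barrier_flux p alpha c i xy)).
have QE : quadratic M (gv x) = quadratic W (gv x) - quadratic B (gv x).
  rewrite /quadratic -sumrB; apply: eq_bigr => i _; rewrite -sumrB.
  by apply: eq_bigr => j _; rewrite ME mulrBr.
have trE : \sum_i M i i = \sum_i W i i - \sum_i B i i.
  by rewrite -sumrB; apply: eq_bigr => i _; rewrite ME.
have e0 : 0 <= enorm (gv x) `^ (p - 2) by exact: powR_ge0.
have le1 : - (barrier_weight p alpha c (sqn (x - y)) *
    (n%:R + p - 2 - 2 * alpha * (p - 1) * sqn (x - y))) <= divergence (pflux p h) x.
  rewrite divv divh ler_wpM2l//; move: tr; rewrite trE QE; lra.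
have wt0 : 0 < barrier_weight p alpha c (sqn (x - y)) by exact: expR_gt0.
move: le1; rewrite divP drift_pflux -[pflux p h x]/(pvec p (grad h x)) gvE /gv pvec_barrier//.
have -> : dot x (- barrier_weight p alpha c (sqn (x - y)) *: (x - y)) =
    - (barrier_weight p alpha c (sqn (x - y)) * dot x (x - y)).
  by rewrite /dot mulr_sumr -sumrN; apply: eq_bigr => i _; rewrite !mxE; ring.
rewrite mulrN lerN2 mulrCA ler_pM2l//; lra.
Qed.

Lemma classical_comparison : comparison_property p K h.
Proof.
move=> alpha c k y U C ac0 oU cC CU UC Ccond x1 Ux1.
rewrite leNgt; apply/negP => hv1.
pose u (z : V) : R := barrier alpha c k y z - h z.
have ch : continuous h by move=> x; apply: differentiable_continuous; case: hsol.
have cu : continuous u.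
  by move=> x; apply: continuous_at_sub; [exact: continuous_barrier|exact: ch].
have Cx1 : C x1 by apply: UC => //; exact: ltW.
have [x0 + x0max] := compact_EVT_max (ex_intro _ x1 Cx1) cC (continuous_subspaceT cu).
rewrite inE => Cx0.
have u0 : 0 < u x0.
  by apply: (lt_le_trans (_ : 0 < u x1)); [rewrite subr_gt0|apply: x0max; rewrite inE].
have [x0y] := Ccond _ Cx0; rewrite ltNge => /negP; apply.
apply: (local_max_contra (c := c) (k := k)) => //.
(* The maximum over [C] is a local maximum in space: points of [U] off [C] have [u < 0 < u x0]. *)
have : \forall z \near x0, U z by apply: open_nbhs_nbhs; split=> //; exact: CU.
apply: filterS => z Uz; have [Cz|Cz] := pselect (C z).
  by apply: x0max; rewrite inE.
apply: ltW; apply: le_lt_trans u0; rewrite /u subr_le0 leNgt; apply/negP => hv.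
by apply: Cz; apply: UC => //; exact: ltW.
Qed.

End ClassicalComparison.

(** * From comparison to constancy *)

Section Liouville.
Context {R : realType} {n : nat}.
Local Notation V := 'rV[R]_n.
Implicit Types (x y z : V).

Lemma sqn0 : sqn (0 : V) = 0.
Proof. by apply/eqP; rewrite sqn_eq0. Qed.

Lemma closed_le_continuous (f : V -> R) (r : R) : continuous f -> closed [set x | f x <= r].
Proof.
move=> cf; have -> : [set x : V | f x <= r] = f @^-1` [set s | s <= r] by [].
by apply: closed_comp; [move=> x _; exact: cf|exact: closed_le].
Qed.

Lemma compact_sqn_ball z (r : R) : compact [set x : V | sqn (x - z) <= r].
Proof.
apply: (subclosed_compact _ (@rV_compact_ball R n (`|z| + (`|r| + 1)))).
  by apply: closed_le_continuous; exact: continuous_sqn.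
move=> x /= xr; rewrite -(subrK z x) addrC (le_trans (ler_normD _ _))// lerD2l.
rewrite leNgt; apply/negP => H; have := normr_sqn (x - z).
have := ler_norm r; have := normr_ge0 r; nra.
Qed.

Lemma compact_min_gt0 (A : set V) (f : V -> R) : compact A -> continuous f ->
  (forall x, A x -> 0 < f x) -> exists2 d, 0 < d & forall x, A x -> d <= f x.
Proof.
move=> cA cf f0; have [->|/set0P A0] := eqVneq A set0; first by exists 1.
have [x xA H] := compact_EVT_min A0 cA (continuous_subspaceT cf).
rewrite inE in xA; exists (f x); first exact: f0.
by move=> z Az; apply: H; rewrite inE.
Qed.

(** By polarisation 2 x.(x-y) = |x|^2 + |x-y|^2 - |y|^2. The bound is uniform in [x] and controls
    the drift in the Hopf argument. *)
Lemma dot_sub_ge x y : - (sqn y / 2) <= dot x (x - y).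
Proof.
have -> : dot x (x - y) = sqn (x - y) + dot y (x - y).
  by rewrite /dot /sqn -big_split /=; apply: eq_bigr => i _; rewrite !mxE; ring.
have := sqn_ge0 (1 *: y + 1 *: (x - y)); rewrite sqn_comb.
by have := sqn_ge0 (x - y); lra.
Qed.

Variables (p K : R) (h : V -> R).
Hypotheses (p1 : 1 < p) (K0 : 0 < K) (h0 : forall x, 0 <= h x) (ch : continuous h).
Hypothesis comparison : comparison_property p K h.

Lemma attains_min : exists xm, forall x, h xm <= h x.
Proof.
(* Beyond squared radius [r], half of the drift K |z|^2 already exceeds [n%:R + p - 2]. *)
pose r := 2 * `|n%:R + p - 2| / K + 1.
have r0 : 0 < r by rewrite ltr_wpDl// divr_ge0 ?mulr_ge0// ltW.
have B0 : [set x : V | sqn (x - 0) <= r] !=set0.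
  by exists 0; rewrite /= subr0 sqn0 ltW.
have [xm _ xm_min] := compact_EVT_min B0 (@compact_sqn_ball 0 r) (continuous_subspaceT ch).
exists xm => x; apply/ler_addgt0Pr => e e0.
(* With [alpha = - a] the barrier term is -K |z|^2 / 2, exactly half of the drift. *)
pose a := K / (4 * (p - 1)).
have a0 : 0 < a by rewrite divr_gt0// mulr_gt0// subr_gt0.
have ap : a * (p - 1) = K / 4 by rewrite /a; field; rewrite gt_eqF// subr_gt0.
(* Makes the barrier at the given [x] equal to [h xm - e]. *)
pose eps := e / 2 / expR (a * sqn (x - 0)).
have eps0 : 0 < eps by rewrite !divr_gt0// expR_gt0.
pose k := h xm - e / 2.
pose b := barrier (- a) (- eps) k (0 : V).
have cb : continuous b by exact: continuous_barrier.
have bE z : b z = k - eps * expR (a * sqn (z - 0)) by rewrite /b /barrier opprK; ring.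
(* Inside the ball of squared radius [r] the barrier stays below [h xm <= h], so [C] lies outside
   it. [C] is bounded because [h >= 0], while exp(t) >= 1 + t forces the barrier below 0 far
   away. *)
pose C := [set z : V | h z - b z <= 0].
have C_out z : C z -> r < sqn (z - 0).
  rewrite /C /= => Cz; rewrite ltNge; apply/negP => zr.
  have := xm_min z; rewrite inE => /(_ zr); move: Cz; rewrite bE /k.
  by have := mulr_gt0 eps0 (expR_gt0 (a * sqn (z - 0))); lra.
have cC : compact C.
  apply: (subclosed_compact _ (@compact_sqn_ball 0 (k / (eps * a)))).
    apply: closed_le_continuous => z; apply: continuous_at_sub; [exact: ch|exact: cb].
  move=> z; rewrite /C /= bE => Cz; rewrite (ler_pdivlMr _ _ (mulr_gt0 eps0 a0)).
  have : eps * (1 + a * sqn (z - 0)) <= eps * expR (a * sqn (z - 0)).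
    by rewrite ler_wpM2l ?expR_ge1Dx// ltW.
  by have := h0 z; lra.
have ac : 0 < - a * - eps by rewrite mulrNN; exact: mulr_gt0.
have := @comparison (- a) (- eps) k 0 setT C ac openT cC (fun _ _ => I) _ _ x I.
rewrite -/(b x) bE {1}/eps divfK ?gt_eqF ?expR_gt0// => H.
suff : k - e / 2 <= h x by rewrite /k; lra.
apply: H => [z _ hz|z Cz].
  by rewrite /C /= subr_le0.
have zr := C_out _ Cz; have z0 : 0 < sqn (z - 0) by exact: lt_trans zr.
split; first by rewrite -subr_eq0 -sqn_gt0.
have -> : dot z (z - 0) = sqn (z - 0) by rewrite subr0.
have -> : 2 * - a * (p - 1) * sqn (z - 0) = - (2 * (a * (p - 1)) * sqn (z - 0)) by ring.
rewrite ap; have := ler_norm (n%:R + p - 2).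
have : K * r < K * sqn (z - 0) by rewrite ltr_pM2l.
have -> : K * r = 2 * `|n%:R + p - 2| + K by rewrite /r; field; rewrite gt_eqF.
have -> : 2 * (K / 4) * sqn (z - 0) = K * sqn (z - 0) / 2 by field.
move: (K * sqn (z - 0)) (`|n%:R + p - 2|) (n%:R + p - 2) => S N m; move: K0; lra.
Qed.

(* Hopf: a ball in [m < h] touching the minimum set at one point [z0] carries a
   barrier that comparison would push strictly above [h z0]. *)
Lemma comparison_constant : exists m, forall x, h x = m.
Proof.
have [xm xm_min] := attains_min; exists (h xm) => x1; apply/eqP; rewrite eq_le xm_min andbT.
rewrite leNgt; apply/negP => hx1; set m := h xm in xm_min hx1 *.
(* The point of the minimum set nearest to [x1] is sought among those no farther than [xm], to have
   compactness. *)
pose Z := [set z : V | sqn (z - x1) <= sqn (xm - x1)] `&` [set z | h z <= m].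
have cZ : compact Z.
  by apply: compact_closedI; [exact: compact_sqn_ball|exact: closed_le_continuous].
have Zn : Z !=set0 by exists xm; split=> /=.
have [z0 + z0_min] := compact_EVT_min Zn cZ (continuous_subspaceT (@continuous_sqn R n x1)).
rewrite inE => -[z0x1 hz0].
have near_min z : h z <= m -> sqn (z0 - x1) <= sqn (z - x1).
  move=> hz; have [zx|/ltW xz] := leP (sqn (z - x1)) (sqn (xm - x1)).
    by apply: z0_min; rewrite inE.
  exact: le_trans xz.
(* The ball centred at the midpoint and through [z0] touches the larger ball about [x1] only at
   [z0], so contact with the minimum set is at one point. *)
pose y := x1 + 2^-1 *: (z0 - x1).
pose r := sqn (z0 - y).
have z0yE : z0 - y = 2^-1 *: (z0 - x1).
  rewrite /y opprD addrA -{1}[z0 - x1]scale1r -scalerBl; congr (_ *: _).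
  by field.
have z0x1n : z0 != x1 by apply: contraTneq hz0 => ->; rewrite -ltNge.
have d0 : 0 < sqn (z0 - x1) by rewrite sqn_gt0 subr_eq0.
have rE : r = sqn (z0 - x1) / 4 by rewrite /r z0yE sqnZ; field.
have r0 : 0 < r by rewrite rE divr_gt0.
have touch z : h z <= m -> sqn (z - y) <= r -> z = z0.
  move=> hz zr; have zx := near_min z hz.
  have E1 : sqn (z - y) = sqn (z - x1) - dot (z - x1) (z0 - x1) + sqn (z0 - x1) / 4.
    have -> : z - y = 1 *: (z - x1) + (- 2^-1) *: (z0 - x1).
      by rewrite scale1r scaleNr /y opprD addrA.
    by rewrite sqn_comb; field.
  have E2 : sqn (z - z0) = sqn (z - x1) - 2 * dot (z - x1) (z0 - x1) + sqn (z0 - x1).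
    have -> : z - z0 = (z - x1) - (z0 - x1) by rewrite opprB addrA subrK.
    by rewrite sqnB.
  apply/eqP; rewrite -subr_eq0 -sqn_eq0 eq_le sqn_ge0 andbT E2.
  by move: zr; rewrite E1 rE; lra.
(* A strict upper bound for [n%:R + p - 2 - K * dot z (z - y)], by [dot_sub_ge]. The choice of [al]
   makes [2 * al * (p - 1) * s] equal to [L] at [s = r / 4]. *)
pose L := `|n%:R + p - 2| + K * (sqn y / 2) + 1.
have L0 : 0 < L.
  rewrite ltr_wpDl// addr_ge0//; apply: mulr_ge0; first exact: ltW.
  by rewrite divr_ge0// sqn_ge0.
pose al := 2 * L / ((p - 1) * r).
have al0 : 0 < al by rewrite divr_gt0 ?mulr_gt0// subr_gt0.
have alE : al * ((p - 1) * r) = 2 * L.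
  by rewrite /al divfK// gt_eqF// mulr_gt0// subr_gt0.
clearbody al.
pose f c k z := h z - barrier al c k y z.
have cf c k : continuous (f c k).
  by move=> z; apply: continuous_at_sub; [exact: ch|exact: continuous_barrier].
(* A small sphere about [z0], written as two inequalities so that it is visibly closed. *)
pose S := [set z : V | sqn (z - z0) <= r / 4] `&` [set z | - sqn (z - z0) <= - (r / 4)].
have cns : continuous (fun z : V => - sqn (z - z0)).
  move=> z; rewrite (_ : (fun z : V => _) = fun z => -1 * sqn (z - z0)); last first.
    by apply/funext => t; rewrite mulN1r.
  by apply: continuous_at_mul; [exact: continuous_at_cst|exact: continuous_sqn].
have cS : compact S.
  by apply: compact_closedI; [exact: compact_sqn_ball|exact: closed_le_continuous].
have Sz0 z : S z -> z != z0.
  by move=> [_ /= zr]; apply/eqP => zE; move: zr; rewrite zE subrr sqn0; lra.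
have [d dpos Hd] : exists2 d, 0 < d &
    forall z, (S `&` [set z | sqn (z - y) <= r]) z -> d <= h z - m.
  apply: compact_min_gt0.
  - apply: compact_closedI => //; apply: closed_le_continuous; exact: continuous_sqn.
  - by move=> z; apply: continuous_at_sub; [exact: ch|exact: continuous_at_cst].
  move=> z [/Sz0 zz0 /= zr]; rewrite subr_gt0 ltNge; apply/negP => hz.
  by move: zz0; rewrite (touch _ hz zr) eqxx.
(* Within the ball about [y], the barrier exceeds [m] by less than [c], hence by less than the gap
   [d] that [h] has on [S]. *)
pose c := d / 2; have c0 : 0 < c by rewrite divr_gt0.
(* Normalises the barrier to equal [m] on the sphere through [z0], so that it lies below [m]
   outside. *)
pose k := m - c * expR (- al * r).
have bE k' z : barrier al c (k' + k) y z =
    k' + m + c * (expR (- al * sqn (z - y)) - expR (- al * r)).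
  by rewrite /barrier /k; ring.
have ac0 : 0 < al * c by exact: mulr_gt0.
(* A positive gap on all of [S] permits raising the barrier by [eta / 2] without reaching [h] there;
   at [z0] the raised barrier is above [m]. *)
have [eta eta0 Heta] : exists2 eta, 0 < eta & forall z, S z -> eta <= f c k z.
  apply: compact_min_gt0 => // z Sz; rewrite /f -[k]add0r bE subr_gt0 add0r.
  have [zr|rz] := leP (sqn (z - y)) r.
    have := Hd z (conj Sz zr).
    have : c * expR (- al * sqn (z - y)) <= c * 1.
      apply: ler_wpM2l; first exact: ltW.
      rewrite -[leRHS]expR0 ler_expR mulNr oppr_le0 mulr_ge0 ?sqn_ge0//; exact: ltW.
    have : 0 < c * expR (- al * r) by rewrite mulr_gt0// expR_gt0.
    by rewrite /c; lra.
  apply: lt_le_trans (xm_min z).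
  rewrite gtrDl pmulr_rlt0// subr_lt0 ltr_expR !mulNr ltrN2 ltr_pM2l//.
pose U := [set z : V | sqn (z - z0) < r / 4].
have oU : open U.
  rewrite /U (_ : [set z : V | _] = (fun z => sqn (z - z0)) @^-1` [set s | s < r / 4])//.
  by apply: open_comp; [move=> z _; exact: continuous_sqn|exact: open_lt].
pose C := [set z : V | sqn (z - z0) <= r / 4] `&` [set z | f c (eta / 2 + k) z <= 0].
have cC : compact C.
  by apply: compact_closedI; [exact: compact_sqn_ball|exact: closed_le_continuous].
have CU : C `<=` U.
  move=> z [/= zr fz]; rewrite /U /= lt_neqAle zr andbT; apply/eqP => zE.
  have := Heta z; rewrite /S /= zE => /(_ (conj (lexx _) (lexx _))).
  move: fz; rewrite /f bE -[k in barrier _ _ k]add0r bE; lra.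
have UC z : U z -> h z <= barrier al c (eta / 2 + k) y z -> C z.
  by rewrite /U /= => Uz hz; split; rewrite /= ?subr_le0// ltW.
have Ccond z : C z -> z != y /\
    n%:R + p - 2 < K * dot z (z - y) + 2 * al * (p - 1) * sqn (z - y).
  move=> /CU; rewrite /U /= => zz0.
  (* From |a+b|^2 <= 2|a|^2 + 2|b|^2: points of [U] keep away from the centre [y]. *)
  have zy : r / 4 < sqn (z - y).
    have : sqn (z0 - y) <= 2 * sqn (z0 - z) + 2 * sqn (z - y).
      have := sqn_ge0 (1 *: (z0 - z) + (-1) *: (z - y)).
      have -> : z0 - y = 1 *: (z0 - z) + 1 *: (z - y) by rewrite !scale1r addrA subrK.
      by rewrite !sqn_comb; lra.
    have -> : sqn (z0 - z) = sqn (z - z0) by rewrite -opprB -scaleN1r sqnZ; ring.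
    by rewrite -/r; lra.
  split; first by rewrite -subr_eq0 -sqn_gt0; apply: lt_trans zy; lra.
  have H1 : - (K * (sqn y / 2)) <= K * dot z (z - y).
    by rewrite -mulrN ler_wpM2l ?dot_sub_ge// ltW.
  have H2 : L <= 2 * al * (p - 1) * sqn (z - y).
    have -> : L = 2 * al * (p - 1) * (r / 4) by move: alE; lra.
    apply: ler_wpM2l; last exact: ltW.
    by rewrite !mulr_ge0 ?(ltW al0)// subr_ge0 ltW.
  by have := ler_norm (n%:R + p - 2); move: H1 H2; rewrite /L; lra.
have Uz0 : U z0 by rewrite /U /= subrr sqn0 divr_gt0.
have := comparison ac0 oU cC CU UC Ccond Uz0.
by rewrite bE -/r subrr mulr0 addr0; move: hz0; rewrite /=; lra.
Qed.

End Liouville.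

Theorem proposition3p2 (R : realType) (n : nat) (p K : R)
    (h : 'rV[R]_n -> R)
    (hp : 1 < p) (hK : 0 < K)
    (h_ge0 : forall x : 'rV[R]_n, 0 <= h x)
    (h_sol : classical_solution p K h \/ weak_solution p K h) :
  exists c : R, forall x : 'rV[R]_n, h x = c.
Proof.
have dh x : differentiable h x by case: h_sol => [[]|[[]]].
apply: (@comparison_constant R n p K) => //.
  by move=> x; exact: differentiable_continuous.
by case: h_sol; [exact: classical_comparison|exact: weak_comparison].
Qed.
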